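(* Let $L:\mathbb{T}^d\times\mathbb{R}^d\to\mathbb{R}$ be continuous with $\lim_{|v|\to\infty}\inf_{x\in\mathbb{T}^d}L(x,v)/|v|=+\infty$. Then a Mather measure $\mu$ exists. Moreover, if $(\varphi,\overline{H})$ is a viscosity solution to $H(x,-\nabla\varphi)=\overline{H}$ (so $\overline{H}$ is the Mañé critical value), then \[\int_{\mathbb{T}^d\times\mathbb{R}^d}L(x,v)\,\mu(d(x,v))=-\overline{H}.\]
   Context: $\mathbb{T}^d=\mathbb{R}^d/\mathbb{Z}^d$. $H(x,p)=\max_{v\in\mathbb{R}^d}[pv-L(x,v)]$. Hadamard sub/superdifferentials: $p\in\partial_D^\mp\varphi(x)$ iff for all $w$, $\liminf_{h\downarrow0,w'\to w}\frac{\varphi(x+hw')-\varphi(x)}{h}\ge pw$ (resp. $\limsup\ldots\le pw$). $(\varphi,\overline{H})$, $\varphi$ continuous, $\overline{H}\in\mathbb{R}$, is a viscosity solution if $H(x,-p)\le\overline{H}$ for $p\in\partial_D^+\varphi(x)$ and $H(x,-p)\ge\overline{H}$ for $p\in\partial_D^-\varphi(x)$, for all $x$. A probability measure $\nu$ on $\mathbb{T}^d\times\mathbb{R}^d$ is holonomic if $\int\nabla\phi(x)v\,\nu(d(x,v))=0$ for every $\phi\in C^1(\mathbb{T}^d)$ ($\nabla\phi(x)$ a row vector). A Mather measure is a holonomic probability measure $\mu$ with $\int L\,d\mu=\inf\{\int L\,d\nu:\nu\text{ holonomic}\}$. *)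

(* Defs.v *)
From HB Require Import structures.
From mathcomp Require Import all_boot all_order all_algebra.
From mathcomp Require Import all_classical all_reals all_analysis.

Set Implicit Arguments.
Unset Strict Implicit.
Unset Printing Implicit Defensive.

Import Order.TTheory GRing.Theory Num.Theory.
Import numFieldNormedType.Exports.

Local Open Scope classical_set_scope.
Local Open Scope ring_scope.

(* Conventions:
   - a point of R^d is a row vector 'rV[R]_d (analysis side) ;
   - T^d = R^d / Z^d : functions on T^d are Z^d-periodic functions on R^d ;
   - for measures, R^d is represented by d.-tuple R with its product (= Borel)
     sigma-algebra; a probability measure on T^d x R^d is a probability measure
     on R^d x R^d concentrated on [0,1)^d x R^d (the fundamental domain). *)

Section Mather.
Context {R : realType} {d : nat}.

Definition rowt (t : d.-tuple R) : 'rV[R]_d := \row_i tnth t i.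

Definition dotv (p v : 'rV[R]_d) : R := \sum_i p ord0 i * v ord0 i.
Definition enorm (v : 'rV[R]_d) : R := Num.sqrt (dotv v v).

Definition int_shift (k : 'rV[int]_d) : 'rV[R]_d := map_mx (fun z : int => z%:~R) k.

Definition periodic (f : 'rV[R]_d -> R) : Prop :=
  forall x k, f (x + int_shift k) = f x.

Definition periodic_lagrangian (L : 'rV[R]_d -> 'rV[R]_d -> R) : Prop :=
  forall x v k, L (x + int_shift k) v = L x v.

(* lim_{|v| -> oo} inf_x L(x,v)/|v| = +oo, written out *)
Definition superlinear (L : 'rV[R]_d -> 'rV[R]_d -> R) : Prop :=
  forall M : R, exists r : R, forall x v, r < enorm v -> M * enorm v <= L x v.

Definition Ham (L : 'rV[R]_d -> 'rV[R]_d -> R) (x p : 'rV[R]_d) : R :=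
  sup (range (fun v => dotv p v - L x v)).

(* Hadamard subdifferential: for all w,
   liminf_{h -> 0+, w' -> w} (phi(x+hw') - phi(x))/h >= p w *)
Definition hsubdiff (phi : 'rV[R]_d -> R) (x p : 'rV[R]_d) : Prop :=
  forall w (e : R), 0 < e ->
    \forall h \near 0^'+ & w' \near w,
       dotv p w - e <= (phi (x + h *: w') - phi x) / h.

Definition hsuperdiff (phi : 'rV[R]_d -> R) (x p : 'rV[R]_d) : Prop :=
  forall w (e : R), 0 < e ->
    \forall h \near 0^'+ & w' \near w,
       (phi (x + h *: w') - phi x) / h <= dotv p w + e.

Definition viscosity_solution (L : 'rV[R]_d -> 'rV[R]_d -> R)
    (phi : 'rV[R]_d -> R) (Hbar : R) : Prop :=
  [/\ continuous phi, periodic phi,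
      (forall x p, hsuperdiff phi x p -> Ham L x (- p) <= Hbar) &
      (forall x p, hsubdiff phi x p -> Hbar <= Ham L x (- p))].

Definition C1 (phi : 'rV[R]_d -> R) : Prop :=
  (forall x, differentiable phi x) /\
  (forall i : 'I_d, continuous (fun x => 'D_(delta_mx ord0 i) phi x)).

Definition cube : set (d.-tuple R) :=
  [set t | forall i, 0 <= tnth t i < 1].

Definition PM := probability (d.-tuple R * d.-tuple R)%type R.

Definition torus_measure (nu : PM) : Prop := nu (cube `*` setT) = 1%E.

Definition holonomic (nu : PM) : Prop :=
  torus_measure nu /\
  forall phi, C1 phi -> periodic phi ->
    nu.-integrable setT (fun z => ('d phi (rowt z.1) (rowt z.2))%:E) /\
    (\int[nu]_z ('d phi (rowt z.1) (rowt z.2))%:E = 0)%E.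

Definition action (L : 'rV[R]_d -> 'rV[R]_d -> R) (nu : PM) : \bar R :=
  (\int[nu]_z (L (rowt z.1) (rowt z.2))%:E)%E.

Definition Mather_measure (L : 'rV[R]_d -> 'rV[R]_d -> R) (mu : PM) : Prop :=
  holonomic mu /\
  action L mu = ereal_inf [set action L nu | nu in [set nu | holonomic nu]].

End Mather.

(* Main.v *)
(** Let [lam] be the supremum of the [l] such that [l <= L(x,v) + dpsi(x) v] for
    some C^1 function [psi] on the torus. Integrating this inequality bounds the
    action of every holonomic measure below by [lam]. The bound is attained:
    superlinearity confines the velocities that matter to a compact box, and
    Hahn-Banach gives a positive normalized functional that vanishes on all
    [dpsi(x) v] and is at most [lam] at [L]. To represent it by a measure, the
    functional is set up on functions on [0, 1], pulled back along a
    space-filling curve in the box, so that the one-dimensional Riesz theorem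
    (a Stieltjes measure) suffices; the curve carries the measure to the box.

    A viscosity solution [(phi, Hbar)] forces [lam = - Hbar]. At a minimum point
    of [phi - psi] the gradient of [psi] is a subgradient of [phi], hence
    [lam <= - Hbar]. Conversely, the sup-convolution of [phi] satisfies
    [S(x+tv) >= S(x) - t (L(x,v) + Hbar + e) - C t^2] on bounded velocities;
    averaging over small cubes preserves this up to a small error and yields a
    C^1 function, hence [lam >= - Hbar]. *)

Require Import Defs.
From HB Require Import structures.
From mathcomp Require Import all_boot all_order all_algebra.
From mathcomp Require Import all_classical all_reals all_analysis measurable_realfun.
From mathcomp Require Import ring lra.
Import Order.TTheory GRing.Theory Num.Theory.
Import numFieldNormedType.Exports.
Local Open Scope classical_set_scope.
Local Open Scope ring_scope.

Set Implicit Arguments.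
Unset Strict Implicit.
Unset Printing Implicit Defensive.

(** No compactness of a space of measures is used: [lam] is the value of a linear program, and the
    measure is its multiplier. Because [lam] is a supremum, no [L - lam + dpsi] stays above a
    positive constant; superlinearity locates the failure in one box that does not depend on [psi],
    and this is what makes the separation possible. The functional is defined on all functions
    bounded on [0, 1], so that it can be evaluated on indicators of half-lines and yields a
    distribution function. It is only finitely additive, hence the functional and the integral are
    compared on continuous functions alone. These are also the reason why a curve with dense image
    is enough. For the viscosity part the obstacle is that [phi] is merely continuous, so there is
    no gradient to mollify. Sup-convolution replaces the differential inequality by a
    finite-difference one with a quadratic error. For a fixed increment it involves only values of
    the function, so it survives averaging; it is differentiated only afterwards. Averages are
    iterated one-dimensional ones, whose partial derivatives are difference quotients, hence
    continuous. *)

Section Preliminaries.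
Context {R : realType}.

Lemma continuous_epsP {V W : normedModType R} (f : V -> W) (x : V) :
  {for x, continuous f} <->
  forall e : R, 0 < e -> exists2 dl : R, 0 < dl &
    forall y, `|x - y| < dl -> `|f x - f y| < e.
Proof.
split=> [cf e e0|h].
  have /cvgrPdist_lt/(_ e e0)/nbhs_ballP[dl /= dl0 dlP] := cf.
  by exists dl => // y xy; apply: dlP; rewrite -ball_normE.
apply/cvgrPdist_lt => e e0; have [dl dl0 dlP] := h e e0.
by apply/nbhs_ballP; exists dl => //= y; rewrite -ball_normE /= => /dlP.
Qed.

(** Only [x] is confined to [K]. The asymmetry serves periodic functions: the integer shift that
    brings [x] into the unit cube may leave [y] outside it. *)
Lemma compact_unif_continuous {V W : normedModType R} (K : set V) (f : V -> W) :
  compact K -> (forall x, K x -> {for x, continuous f}) ->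
  forall e : R, 0 < e -> exists2 dl : R, 0 < dl &
    forall x y, K x -> `|x - y| < dl -> `|f x - f y| < e.
Proof.
move=> /compact_near_coveringP cK cf e e0.
have [] := cK R (0^'+) (fun dl x => forall y, `|x - y| < dl -> `|f x - f y| < e) _.
  move=> x Kx.
  have [d0 d00 d0P] := (continuous_epsP f x).1 (cf _ Kx) _ (divr_gt0 e0 (ltr0n R 2)).
  exists (ball x (d0 / 2), [set r : R | 0 < r < d0 / 2]).
    split; first by apply: nbhsx_ballx; rewrite divr_gt0.
    exists (d0 / 2); first by rewrite /= divr_gt0.
    by move=> r /=; rewrite sub0r normrN => + r0; rewrite gtr0_norm// => ->; rewrite r0.
  move=> [x' r] [/=]; rewrite -ball_normE /= => xx' /andP[_ rd] y x'y.
  rewrite -(subrKA (f x)) (le_lt_trans (ler_normD _ _))//.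
  rewrite [e]splitr ltrD//.
    rewrite distrC; apply: d0P; rewrite (lt_le_trans xx')//.
    lra.
  apply: d0P; rewrite -(subrKA x') (le_lt_trans (ler_normD _ _))// [d0]splitr.
  by rewrite ltrD// (lt_trans x'y).
move=> dl /= dl0 dlP.
have h0 : 0 < dl / 2 by rewrite divr_gt0.
exists (dl / 2) => // x y Kx.
have /dlP : ball_ Num.norm 0 dl (dl / 2).
  by rewrite /= sub0r normrN gtr0_norm//; lra.
by move=> /(_ h0); apply.
Qed.

End Preliminaries.

(** * Hahn-Banach theorem on a subspace given by a predicate *)

Section HahnBanach.
Context {R : realType} {V : lmodType R} (B : V -> Prop).
Hypothesis BD : forall x y, B x -> B y -> B (x + y).
Hypothesis BZ : forall a x, B x -> B (a *: x).

Definition sublinear_on (q : V -> R) : Prop :=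
  (forall x y, B x -> B y -> q (x + y) <= q x + q y) /\
  (forall a x, 0 <= a -> B x -> q (a *: x) <= a * q x).

Lemma sublinear_on0 q x : sublinear_on q -> B x -> q 0 = 0.
Proof.
move=> [qD qZ] Bx; have B0 : B 0 by rewrite -(scale0r x); exact: BZ.
apply/eqP; rewrite eq_le; apply/andP; split.
  by have := qZ 0 0 (lexx _) B0; rewrite scale0r mul0r.
by have := qD 0 0 B0 B0; rewrite addr0 -lerBlDl subrr.
Qed.

Lemma sublinear_onZ q (a : R) x :
  sublinear_on q -> 0 <= a -> B x -> q (a *: x) = a * q x.
Proof.
move=> sq; rewrite le_eqVlt => /orP[/eqP <- Bx|a0 Bx].
  by rewrite scale0r mul0r (@sublinear_on0 _ x).
apply/eqP; rewrite eq_le (proj2 sq _ _ (ltW a0) Bx)/=.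
have a'0 : 0 <= a^-1 by rewrite invr_ge0 ltW.
have := proj2 sq _ _ a'0 (BZ a Bx); rewrite scalerA mulVf ?gt_eqF// scale1r.
by rewrite ler_pdivlMl.
Qed.

Lemma sublinear_on_opp q x : sublinear_on q -> B x -> - q (- x) <= q x.
Proof.
move=> sq Bx; have BNx : B (- x) by rewrite -scaleN1r; exact: BZ.
have := proj1 sq x (- x) Bx BNx.
by rewrite subrr (sublinear_on0 sq Bx) -lerBlDr sub0r.
Qed.

(** Subadditivity survives the infimum because, of two members used at [x] and at [y], one lies
    below the other and serves at both points. The bound [- p (- x)] keeps the infimum finite. *)
Lemma chain_inf_sublinear (p : V -> R) (A : set (V -> R)) : A !=set0 ->
  (forall q, A q -> sublinear_on q /\ forall x, B x -> q x <= p x) ->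
  (forall q r, A q -> A r -> (forall x, B x -> q x <= r x) \/
                             (forall x, B x -> r x <= q x)) ->
  let m x := inf [set q x | q in A] in
  sublinear_on m /\ forall q x, A q -> B x -> m x <= q x.
Proof.
move=> [q0 Aq0] Ap Atot m.
have BN x : B x -> B (- x) by rewrite -scaleN1r; exact: BZ.
have lb x : B x -> has_lbound [set q x | q in A].
  move=> Bx; exists (- p (- x)) => _ [q Aq <-].
  have [sq qp] := Ap _ Aq.
  by apply: le_trans (sublinear_on_opp sq Bx); rewrite lerN2 qp//; exact: BN.
have mle q x : A q -> B x -> m x <= q x.
  by move=> Aq Bx; apply: (ge_inf (lb _ Bx)); exists q.
have mge x c : (forall q, A q -> c <= q x) -> c <= m x.
  move=> cq; apply: lb_le_inf; first by exists (q0 x), q0.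
  by move=> _ [q Aq <-]; exact: cq.
split=> //; split=> [x y Bx By|a x a0 Bx].
  rewrite -lerBlDr. apply: (mge _) => q Aq; rewrite lerBlDl -lerBlDr.
  apply: (mge _) => r Ar; rewrite lerBlDr.
  have [qr|rq] := Atot _ _ Aq Ar.
    apply: le_trans (mle q _ Aq (BD Bx By)) _.
    apply: le_trans (proj1 (proj1 (Ap _ Aq)) _ _ Bx By) _.
    by rewrite addrC lerD2r qr.
  apply: le_trans (mle r _ Ar (BD Bx By)) _.
  apply: le_trans (proj1 (proj1 (Ap _ Ar)) _ _ Bx By) _.
  by rewrite addrC lerD2l rq.
move: a0; rewrite le_eqVlt => /orP[/eqP <-|a0].
  rewrite scale0r mul0r; apply: le_trans (mle q0 _ Aq0 _) _.
    by rewrite -(scale0r x); exact: BZ.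
  by rewrite (sublinear_on0 (proj1 (Ap _ Aq0)) Bx).
rewrite mulrC -ler_pdivrMr//; apply: (mge _) => q Aq; rewrite ler_pdivrMr// mulrC.
by apply: le_trans (mle q _ Aq (BZ _ Bx)) (proj2 (proj1 (Ap _ Aq)) _ _ (ltW a0) Bx).
Qed.

(** The functional [q] lowered so that its value at [- y] is at most [- q y]; a [q] that cannot be
    lowered in this way is linear in the direction [y]. *)
Definition slope_inf (q : V -> R) (y x : V) : R :=
  inf [set q (x + t *: y) - t * q y | t in [set t : R | 0 <= t]].

Lemma slope_inf_sublinear (q : V -> R) y : sublinear_on q -> B y ->
  sublinear_on (slope_inf q y) /\
  forall t x, 0 <= t -> B x -> slope_inf q y x <= q (x + t *: y) - t * q y.
Proof.
move=> sq By.
have Bt t x : B x -> B (x + t *: y) by move=> Bx; exact: BD Bx (BZ _ By).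
have sle t x : 0 <= t -> B x -> slope_inf q y x <= q (x + t *: y) - t * q y.
  move=> t0 Bx; apply: ge_inf; last by exists t.
  exists (- q (- x)) => _ [u u0 <-].
  have BNx : B (- x) by rewrite -scaleN1r; exact: BZ.
  rewrite -(sublinear_onZ sq u0 By) lerBrDl lerBlDr.
  have := proj1 sq (x + u *: y) (- x) (Bt _ _ Bx) BNx.
  by rewrite addrAC subrr add0r.
have sge x c : (forall t, 0 <= t -> c <= q (x + t *: y) - t * q y) ->
    c <= slope_inf q y x.
  move=> h; apply: lb_le_inf; last by move=> _ [t t0 <-]; exact: h.
  by exists (q (x + 0 *: y) - 0 * q y), 0 => //=.
split=> //; split=> [x z Bx Bz|a x a0 Bx].
  rewrite -lerBlDr; apply: (sge _) => t t0; rewrite lerBlDl -lerBlDr.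
  apply: (sge _) => u u0; rewrite lerBlDr.
  apply: le_trans (sle (t + u) _ (addr_ge0 t0 u0) (BD Bx Bz)) _.
  have := proj1 sq _ _ (Bt t _ Bx) (Bt u _ Bz).
  rewrite (_ : x + t *: y + (z + u *: y) = x + z + (t + u) *: y); last first.
    by rewrite scalerDl addrACA.
  lra.
move: a0; rewrite le_eqVlt => /orP[/eqP <-|a0].
  rewrite scale0r mul0r; have B0 : B 0 by rewrite -(scale0r x); exact: BZ.
  apply: le_trans (sle 0 _ (lexx _) B0) _.
  by rewrite scale0r mul0r addr0 subr0 (sublinear_on0 sq Bx).
rewrite mulrC -ler_pdivrMr//; apply: (sge _) => t t0; rewrite ler_pdivrMr//.
have at0 : 0 <= a * t by rewrite mulr_ge0// ltW.
apply: le_trans (sle (a * t) _ at0 (BZ _ Bx)) _.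
rewrite -scalerA -scalerDr (sublinear_onZ sq (ltW a0) (Bt _ _ Bx)).
by rewrite le_eqVlt; apply/orP; left; apply/eqP; ring.
Qed.

(* A minimal sublinear functional is additive: it lies below each of its
   [slope_inf]s, and [t = 1] there gives [q x + q y <= q (x + y)]. *)
Theorem Hahn_Banach (p : V -> R) : sublinear_on p ->
  exists f : V -> R,
    [/\ forall x y, B x -> B y -> f (x + y) = f x + f y,
        forall a x, B x -> f (a *: x) = a * f x &
        forall x, B x -> f x <= p x].
Proof.
move=> sp.
pose T := {q : V -> R | sublinear_on q /\ forall x, B x -> q x <= p x}.
(* The order is reversed: a maximal element for [le] is a minimal functional. *)
pose le (r s : T) := `[< forall x, B x -> sval s x <= sval r x >].
have [||A Atot|[q [sq qp]] qmin] := @ZL_preorder T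
    (exist _ p (conj sp (fun x _ => lexx (p x)))) le.
- by move=> t; apply/asboolP.
- move=> r s t /asboolP rs /asboolP st; apply/asboolP => x Bx.
  by apply: le_trans (st _ Bx) (rs _ Bx).
- have [->|/set0P[s0 As0]] := eqVneq A set0.
    by exists (exist _ p (conj sp (fun x _ => lexx (p x)))).
  pose A' := [set sval s | s in A].
  have [| | |smA mA] := @chain_inf_sublinear p A'.
  + by exists (sval s0), s0.
  + by move=> _ [s As <-]; exact: (svalP s).
  + move=> _ _ [s As <-] [t At <-].
    by have [/asboolP st|/asboolP ts] := Atot _ _ As At; [right|left].
  set m := fun x => _ in smA mA.
  have mp x : B x -> m x <= p x.
    move=> Bx; apply: le_trans (mA (sval s0) _ _ Bx) _; first by exists s0.
    exact: (proj2 (svalP s0)).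
  exists (exist _ m (conj smA mp)) => s As; apply/asboolP => x Bx /=.
  by apply: mA => //; exists s.
have qadd x y : B x -> B y -> q x + q y <= q (x + y).
  move=> Bx By; have [ss sle] := slope_inf_sublinear sq By.
  have sp' z : B z -> slope_inf q y z <= q z.
    by move=> Bz; have := sle 0 _ (lexx _) Bz; rewrite scale0r mul0r addr0 subr0.
  have sp2 z : B z -> slope_inf q y z <= p z.
    by move=> Bz; apply: le_trans (sp' _ Bz) (qp _ Bz).
  have := qmin (exist _ _ (conj ss sp2)) => /= H.
  have /asboolP/(_ _ Bx)/= := H (asboolT sp').
  move=> /le_trans/(_ (sle 1 _ ler01 Bx)); rewrite scale1r mul1r; lra.
have qD x y : B x -> B y -> q (x + y) = q x + q y.
  by move=> Bx By; apply/eqP; rewrite eq_le (proj1 sq)// qadd.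
exists q; split=> // a x Bx.
have [a0|a0] := leP 0 a; first exact: sublinear_onZ.
have BNx : B (- x) by rewrite -scaleN1r; exact: BZ.
have Na : 0 <= - a by rewrite oppr_ge0 ltW.
rewrite -[a *: x]opprK -scalerN -scaleNr (sublinear_onZ sq Na BNx).
have := qD x (- x) Bx BNx; rewrite subrr (sublinear_on0 sq Bx).
by move=> /eqP; rewrite eq_sym addrC addr_eq0 => /eqP ->; rewrite mulrNN.
Qed.

End HahnBanach.

(** * A continuous curve with dense image in a cube *)

Section DenseCurve.
Context {R : realType}.

(** With slope 3, each of [0, 1/3] and [2/3, 1] is mapped onto [0, 1]. On these two intervals
    [digit] is exactly 0 and 1, and the gap between them lets it be continuous. *)
Definition tent (t : R) : R := 3 * (2^-1 - `|t - 2^-1|).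
Definition digit (t : R) : R := Num.max 0 (Num.min 1 (3 * t - 1)).

Lemma digit_itv t : 0 <= digit t <= 1.
Proof. by rewrite /digit le_max lexx/= ge_max ler01/= ge_min lexx. Qed.

Lemma digit_lipschitz s t : `|digit s - digit t| <= 3 * `|s - t|.
Proof.
have H (u w : R) : u <= w -> 0 <= digit w - digit u <= 3 * (w - u).
  move=> uw; rewrite /digit /Num.max /Num.min.
  by repeat case: ifPn; rewrite -?leNgt; lra.
have [st|/ltW ts] := leP s t.
  by rewrite distrC [`|s - t|]distrC !ger0_norm ?subr_ge0//; have := H _ _ st; lra.
by rewrite !ger0_norm ?subr_ge0//; have := H _ _ ts; lra.
Qed.

Lemma tent_lipschitz s t : `|tent s - tent t| <= 3 * `|s - t|.
Proof.
rewrite /tent -mulrBr normrM ger0_norm// ler_pM2l//.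
have -> : 2^-1 - `|s - 2^-1| - (2^-1 - `|t - 2^-1|) = `|t - 2^-1| - `|s - 2^-1|.
  by ring.
rewrite (le_trans (ler_dist_dist _ _))// [leRHS]distrC.
by rewrite (_ : t - 2^-1 - (s - 2^-1) = t - s)//; ring.
Qed.

Lemma iter_tent_lipschitz k s t :
  `|iter k tent s - iter k tent t| <= 3 ^+ k * `|s - t|.
Proof.
elim: k => [|k IH]; first by rewrite expr0 mul1r.
rewrite !iterS exprS -mulrA (le_trans (tent_lipschitz _ _))//.
by rewrite ler_pM2l.
Qed.

Definition binary_psum (u : nat -> R) (m : nat) : R :=
  \sum_(i < m) 2^-1 ^+ i.+1 * u i.
Definition binary_sum (u : nat -> R) : R := sup (range (binary_psum u)).

(** The upper bound is the exact sum of the geometric weights between [m] and [m + k], which lets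
    the induction on [k] close. *)
Lemma binary_psum_bound u m k : (forall i, 0 <= u i <= 1) ->
  binary_psum u m <= binary_psum u (m + k) <= binary_psum u m + 2^-1 ^+ m - 2^-1 ^+ (m + k).
Proof.
move=> u01; elim: k => [|k IH]; first by rewrite addn0 addrK !lexx.
rewrite addnS /binary_psum big_ord_recr/= -/(binary_psum _ _).
have := u01 (m + k)%N; rewrite exprS.
have : 0 <= (2^-1 : R) ^+ (m + k) by rewrite exprn_ge0// invr_ge0.
move: IH; rewrite -/(binary_psum u m) -/(binary_psum u (m + k)).
set a := 2^-1 ^+ (m + k); set b := 2^-1 ^+ m.
set p := binary_psum _ _; set q := binary_psum _ _; set w := u _.
by move=> ? ? ?; nra.
Qed.

Lemma binary_sum_bound u m : (forall i, 0 <= u i <= 1) ->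
  binary_psum u m <= binary_sum u <= binary_psum u m + 2^-1 ^+ m.
Proof.
move=> u01.
have ub k : binary_psum u k <= binary_psum u m + 2^-1 ^+ m.
  have [km|/ltnW mk] := leqP k m.
    have := binary_psum_bound k (m - k) u01; rewrite subnKC// => /andP[h _].
    by apply: le_trans h _; rewrite lerDl exprn_ge0// invr_ge0.
  have := binary_psum_bound m (k - m) u01; rewrite subnKC// => /andP[_ h].
  by apply: le_trans h _; rewrite gerBl exprn_ge0// invr_ge0.
apply/andP; split.
  by apply: ub_le_sup; [exists (binary_psum u m + 2^-1 ^+ m) => _ [k _ <-]|exists m].
by apply: ge_sup; [exists (binary_psum u 0), 0%N|move=> _ [k _ <-]].
Qed.

Lemma exp_half_lt (e : R) : 0 < e -> exists m, 2^-1 ^+ m < e.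
Proof.
move=> e0; have /cvgrPdist_lt/(_ e e0)[m _ mP] : (2^-1 : R) ^+ n @[n --> \oo] --> (0 : R).
  by apply: cvg_expr; rewrite ger0_norm ?invr_ge0// invf_lt1// ltr1n.
exists m; have := mP m (leqnn m); rewrite /= sub0r normrN ger0_norm//.
Qed.

(** The inverse branches [t / 3] and [1 - t / 3] of [tent] prepend the digit 0 or 1 and leave the
    later digits intact. *)
Lemma realize_digits m (b : nat -> bool) : exists2 t : R, 0 <= t <= 1 &
  forall k, (k < m)%N -> digit (iter k tent t) = (b k)%:R.
Proof.
elim: m b => [|m IH] b; first by exists 0; rewrite // lexx ler01.
have [t t01 tP] := IH (fun k => b k.+1).
pose s : R := if b 0%N then 1 - t / 3 else t / 3.
have tent_s : tent s = t.
  by rewrite /tent /s; case: (b 0%N);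
    [rewrite ger0_norm; lra|rewrite ler0_norm; lra].
exists s; first by rewrite /s; case: (b 0%N); lra.
case=> [_|k km]; last by rewrite iterSr tent_s tP.
rewrite /= /digit /s /Num.max /Num.min; case: (b 0%N);
  by repeat case: ifPn; rewrite -?leNgt/=; lra.
Qed.

Lemma binary_digits m (z : R) : 0 <= z <= 1 ->
  exists c : nat -> bool, `|binary_psum (fun i => (c i)%:R) m - z| <= 2^-1 ^+ m.
Proof.
elim: m z => [|m IH] z z01.
  exists (fun=> false); rewrite /binary_psum big_ord0 sub0r normrN expr0.
  by rewrite ger0_norm; lra.
have z'01 : 0 <= 2 * z - (2^-1 <= z)%R%:R <= 1.
  by case: (leP 2^-1 z) => /= ?; lra.
have [c cP] := IH _ z'01.
exists (fun i => if i is i'.+1 then c i' else 2^-1 <= z).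
rewrite /binary_psum big_ord_recl/= expr1.
under eq_bigr do rewrite exprS -mulrA.
rewrite -mulr_sumr -/(binary_psum (fun i => (c i)%:R) m).
set p := binary_psum _ _ in cP *.
rewrite (_ : _ - z = 2^-1 * (p - (2 * z - (2^-1 <= z)%R%:R))); last by field.
by rewrite normrM ger0_norm ?invr_ge0// exprS ler_pM2l// invr_gt0.
Qed.

(* Schoenberg's space-filling curve, with the tent map providing the digits. *)
Lemma dense_curve n : exists G : 'I_n -> R -> R,
  [/\ forall j, continuous (G j), forall j t, 0 <= G j t <= 1 &
      forall (z : 'I_n -> R) e, 0 < e -> (forall j, 0 <= z j <= 1) ->
      exists2 t, 0 <= t <= 1 & forall j, `|G j t - z j| < e].
Proof.
(* Coordinate [j] reads the digits whose index is [j] modulo [n], so the coordinates can be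
   prescribed independently. *)
pose u (j : 'I_n) t i := digit (iter (i * n + j) tent t).
have u01 j t i : 0 <= u j t i <= 1 by exact: digit_itv.
exists (fun j t => binary_sum (u j t)); split=> [j t|j t|z e e0 z01].
(* The first [m] digits are Lipschitz in [t], with a constant depending on [m]; the remaining ones
   contribute less than [e / 2]. *)
- apply/continuous_epsP => e e0.
  have [m me] := exp_half_lt (divr_gt0 e0 (ltr0n R 2)).
  pose C : R := \sum_(i < m) 3 ^+ (i * n + j).+1.
  have C0 : 0 <= C by apply: sumr_ge0 => i _; rewrite exprn_ge0.
  have pL s : `|binary_psum (u j t) m - binary_psum (u j s) m| <= C * `|t - s|.
    rewrite /binary_psum -sumrB (le_trans (ler_norm_sum _ _ _))// mulr_suml.
    apply: ler_sum => i _; rewrite -mulrBr normrM.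
    rewrite (le_trans (ler_piMl _ _))//.
      rewrite ger0_norm ?exprn_ge0 ?invr_ge0//.
      by rewrite exprn_ile1 ?invr_ge0// invf_le1// ler1n.
    rewrite /u (le_trans (digit_lipschitz _ _))// exprS -mulrA ler_pM2l//.
    exact: iter_tent_lipschitz.
  exists (e / 2 / (C + 1)); first by rewrite !divr_gt0// ltr_wpDl.
  move=> s ts; have := pL s; have := binary_sum_bound m (u01 j t).
  have := binary_sum_bound m (u01 j s).
  have CE : C * `|t - s| < e / 2.
    rewrite (@le_lt_trans _ _ ((C + 1) * `|t - s|))//.
      by rewrite ler_wpM2r// lerDl.
    by rewrite mulrC -ltr_pdivlMr// ltr_wpDl.
  rewrite ler_norml => ? ? ?; rewrite ltr_norml; lra.
- have := binary_sum_bound 0 (u01 j t); rewrite /binary_psum big_ord0 expr0 add0r.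
  by [].
- have [m me] := exp_half_lt (divr_gt0 e0 (ltr0n R 2)).
  have /choice[c cP] : forall j, exists c : nat -> bool,
      `|binary_psum (fun i => (c i)%:R) m - z j| <= 2^-1 ^+ m.
    by move=> j; exact: binary_digits.
  pose b k := if insub (k %% n)%N is Some j then c j (k %/ n)%N else false.
  have [t t01 tP] := realize_digits (m * n) b.
  exists t => // j.
  have pE : binary_psum (u j t) m = binary_psum (fun i => (c j i)%:R) m.
    apply: eq_bigr => i _; congr (_ * _); rewrite /u tP; last first.
      rewrite (@leq_trans (i * n + n)%N)// ?ltn_add2l// addnC -mulSn.
      by rewrite leq_mul2r ltn_ord orbT.
    have n0 : (0 < n)%N by case: (n) j => [[]|].
    rewrite /b modnMDl modn_small// divnMDl// divn_small// addn0.
    by rewrite valK.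
  have := binary_sum_bound m (u01 j t); have := cP j; rewrite -pE ler_norml.
  move: me; rewrite ltr_norml; lra.
Qed.

End DenseCurve.

(** * Riesz representation of positive functionals on the unit interval *)

Section RieszUnitInterval.
Context {R : realType}.

Let ind (u t : R) : R := (t <= u)%R%:R.
(** The nodes subdivide ]-1, 1] instead of ]0, 1], so that a point mass at 0 is not lost at the open
    end. *)
Let node (N i : nat) : R := -1 + 2 * i%:R / N%:R.

Section PositiveFunctional.
Variables (B : (R -> R) -> Prop) (Phi : (R -> R) -> R).
Hypothesis BD : forall h k, B h -> B k -> B (fun t => h t + k t).
Hypothesis BZ : forall a h, B h -> B (fun t => a * h t).
Hypothesis Bind : forall u, B (ind u).
Hypothesis PhiD : forall h k, B h -> B k -> Phi (fun t => h t + k t) = Phi h + Phi k.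
Hypothesis PhiZ : forall a h, B h -> Phi (fun t => a * h t) = a * Phi h.
Hypothesis Phi_ge0 : forall h, B h -> (forall t, -1 < t <= 1 -> 0 <= h t) -> 0 <= Phi h.
Hypothesis Phi1 : Phi (ind 1) = 1.

Lemma functional_dist_le h k e : B h -> B k ->
  (forall t, -1 < t <= 1 -> `|h t - k t| <= e) -> `|Phi h - Phi k| <= e.
Proof.
move=> Bh Bk hke.
have H h' k' : B h' -> B k' -> (forall t, -1 < t <= 1 -> h' t - k' t <= e) ->
    Phi h' - Phi k' <= e.
  move=> Bh' Bk' le_e.
  have BN := BZ (-1) Bh'; have Be := BZ e (Bind 1).
  have E : Phi (fun t => e * ind 1 t + (k' t + (-1) * h' t)) = e + (Phi k' - Phi h').
    by rewrite (PhiD Be (BD Bk' BN)) (PhiD Bk' BN) !PhiZ// Phi1 mulr1 mulN1r.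
  suff : 0 <= e + (Phi k' - Phi h') by lra.
  rewrite -E; apply: Phi_ge0; first exact: (BD Be (BD Bk' BN)).
  move=> t t1; have := le_e t t1; case/andP: t1 => _ t1.
  have -> : ind 1 t = 1 by rewrite /ind t1.
  lra.
rewrite ler_norml; apply/andP; split.
  rewrite lerNl opprB; apply: H => // t t1.
  by have := hke t t1; rewrite ler_norml; lra.
by apply: H => // t t1; have := hke t t1; rewrite ler_norml; lra.
Qed.

(** On ]-1, 1] the step function taking the values of [h] at right endpoints is within [e] of [h],
    and a normalized positive functional does not increase this distance. The class [B] is abstract
    because the lemma is applied both to [M] and to the integral against [P]. *)
Lemma functional_riemann_sum h e N : (0 < N)%N -> B h -> 0 <= e ->
  (forall s t, -1 <= s <= 1 -> -1 <= t <= 1 -> `|s - t| <= 2 / N%:R -> `|h s - h t| <= e) ->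
  `|Phi h - \sum_(i < N) h (node N i.+1) *
      (Phi (ind (node N i.+1)) - Phi (ind (node N i)))| <= e.
Proof.
move=> N0 Bh e0 osc.
have Np : 0 < N%:R :> R by rewrite ltr0n.
have nodeS i : node N i.+1 = node N i + 2 / N%:R.
  by rewrite /node -natr1; field; rewrite gt_eqF.
have step0 : 0 < 2 / N%:R :> R by rewrite divr_gt0.
pose k m t := \sum_(i < m) h (node N i.+1) * (ind (node N i.+1) t - ind (node N i) t).
have kS m : k m.+1 = fun t => k m t +
    h (node N m.+1) * (ind (node N m.+1) t + (-1) * ind (node N m) t).
  by apply/funext => t; rewrite /k big_ord_recr/= mulN1r.
have kP m : B (k m) /\ Phi (k m) = \sum_(i < m) h (node N i.+1) *
      (Phi (ind (node N i.+1)) - Phi (ind (node N i))).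
  elim: m => [|m [Bk Phik]].
    have -> : k 0%N = fun t => 0 * ind 0 t.
      by apply/funext => t; rewrite /k big_ord0 mul0r.
    by rewrite PhiZ// mul0r big_ord0; split=> //; exact: BZ.
  have B1 := BD (Bind (node N m.+1)) (BZ (-1) (Bind (node N m))).
  rewrite kS; split; first by apply: BD => //; exact: BZ.
  by rewrite PhiD ?PhiZ ?PhiD ?PhiZ// ?mulN1r ?big_ord_recr/= ?Phik//; exact: BZ.
have kh m t : (m <= N)%N -> -1 < t ->
    (t <= node N m -> `|h t - k m t| <= e) /\ (node N m < t -> k m t = 0).
  elim: m => [|m IH] mN t1.
    split; first by rewrite /node mulr0 mul0r addr0 leNgt t1.
    by rewrite /k big_ord0.
  have [le_m gt_m] := IH (ltnW mN) t1; rewrite kS /ind; split.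
    move=> tm; rewrite tm; case: (leP t (node N m)) => [tm'|tm'].
      by rewrite mulr1 subrr mulr0 addr0 le_m.
    rewrite gt_m// mulr0 addr0 mulr1 add0r; apply: osc.
    - rewrite ltW//= (le_trans tm)// /node -lerBrDl ler_pdivrMr//.
      by rewrite (_ : 1 - -1 = 2 :> R) ?ler_pM2l ?ler_nat//; ring.
    - rewrite (le_trans (ltW t1) tm)/= /node -lerBrDl ler_pdivrMr//.
      by rewrite (_ : 1 - -1 = 2 :> R) ?ler_pM2l ?ler_nat//; ring.
    - by rewrite distrC ger0_norm ?subr_ge0//; move: tm'; rewrite nodeS; lra.
  move=> tm; have tm' : node N m < t by move: tm; rewrite nodeS; lra.
  by rewrite gt_m// leNgt tm leNgt tm' /= mulr0 addr0 mulr0 addr0.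
have [Bk <-] := kP N.
apply: functional_dist_le => // t /andP[t1 t2]; apply: (kh N t _ t1).1 => //.
by rewrite /node mulfK ?gt_eqF//; lra.
Qed.

End PositiveFunctional.

Variable M : (R -> R) -> R.
Let bdd (h : R -> R) := exists C, forall t, 0 <= t <= 1 -> `|h t| <= C.
Hypothesis MD : forall h k, bdd h -> bdd k -> M (fun t => h t + k t) = M h + M k.
Hypothesis MZ : forall a h, bdd h -> M (fun t => a * h t) = a * M h.
Hypothesis M_ge0 : forall h, bdd h -> (forall t, 0 <= t <= 1 -> 0 <= h t) -> 0 <= M h.
Hypothesis M1 : M (fun=> 1) = 1.

Let bddD h k : bdd h -> bdd k -> bdd (fun t => h t + k t).
Proof.
move=> [C hC] [D kD]; exists (C + D) => t t01.
by rewrite (le_trans (ler_normD _ _))// lerD ?hC ?kD.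
Qed.

Let bddZ a h : bdd h -> bdd (fun t => a * h t).
Proof.
move=> [C hC]; exists (`|a| * C) => t t01.
by rewrite normrM ler_wpM2l// hC.
Qed.

Let bdd_ind u : bdd (ind u).
Proof. by exists 1 => t _; rewrite /ind; case: (t <= u); rewrite ?normr1 ?normr0. Qed.

Let M_le h k : bdd h -> bdd k -> (forall t, 0 <= t <= 1 -> h t <= k t) -> M h <= M k.
Proof.
move=> bh bk hk; rewrite -subr_ge0.
have -> : M k - M h = M (fun t => k t + (-1) * h t).
  by rewrite MD ?MZ ?mulN1r//; exact: bddZ.
apply: M_ge0; first by apply: bddD => //; exact: bddZ.
by move=> t t01; have := hk t t01; lra.
Qed.

(** The candidate distribution function. As [M] is only finitely additive, [G] may fail to be
    right-continuous. *)
Let G u := M (ind u).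
Let bdd1 : bdd (fun=> 1). Proof. by exists 1 => t _; rewrite normr1. Qed.

Let G_nd u w : u <= w -> G u <= G w.
Proof.
move=> uw; apply: M_le => // t _; rewrite /ind ler_nat.
by case: (leP t u) => // tu; rewrite (le_trans tu uw).
Qed.

Let G_lt0 u : u < 0 -> G u = 0.
Proof.
move=> u0; have E0 : M (fun t => 0 * ind u t) = 0 by rewrite MZ ?mul0r.
have iu t : 0 <= t <= 1 -> 0 * ind u t = ind u t.
  by move=> /andP[t0 _]; rewrite mul0r /ind leNgt (lt_le_trans u0 t0).
have Z : bdd (fun t => 0 * ind u t) by exact: bddZ.
rewrite /G -[RHS]E0; apply/eqP; rewrite eq_le.
by apply/andP; split; apply: M_le => // t /iu ->.
Qed.

Let G_ge1 u : 1 <= u -> G u = 1.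
Proof.
move=> u1; have iu t : 0 <= t <= 1 -> ind u t = 1.
  by move=> /andP[_ t1]; rewrite /ind (le_trans t1 u1).
rewrite /G -[RHS]M1; apply/eqP; rewrite eq_le.
by apply/andP; split; apply: M_le => // t /iu ->.
Qed.

Let G_ge0 u : 0 <= G u. Proof. by apply: M_ge0 => // t _; rewrite /ind ler0n. Qed.

(** The right-continuous regularization of [G]. It may differ from [G] at a node, so the two Riemann
    sums need not agree. *)
Let F t := inf [set G u | u in [set u | t < u]].

Let F_le t u : t < u -> F t <= G u.
Proof. by move=> tu; apply: ge_inf; [exists 0 => _ [w _ <-]|exists u]. Qed.

Let F_ge t c : (forall u, t < u -> c <= G u) -> c <= F t.
Proof.
move=> cG; apply: lb_le_inf; first by exists (G (t + 1)), (t + 1) => //=; rewrite ltrDl.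
by move=> _ [u tu <-]; exact: cG.
Qed.

Let G_le_F t : G t <= F t. Proof. by apply: F_ge => u /ltW /G_nd. Qed.

Let F_nd : nondecreasing F.
Proof. by move=> s t st; apply: F_ge => u tu; apply: F_le; exact: le_lt_trans tu. Qed.

Let F_rc : right_continuous F.
Proof.
move=> t; apply/cvgrPdist_le => e e0.
have [_ [u tu <-] Gu] : exists2 g, [set G u | u in [set u | t < u]] g & g < F t + e.
  apply: inf_adherent => //; split; last by exists 0 => _ [w _ <-].
  by exists (G (t + 1)), (t + 1) => //=; rewrite ltrDl.
near=> s; have ts : t <= s by near: s; exact: nbhs_right_ge.
have su : s < u by near: s; exact: nbhs_right_lt.
rewrite distrC ger0_norm ?subr_ge0 ?F_nd//.
by have := F_le su; lra.
Unshelve. all: by end_near. Qed.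

Let F_lt0 t : t < 0 -> F t = 0.
Proof.
move=> t0; apply/eqP; rewrite eq_le -{1}(@G_lt0 (t / 2)) ?F_le//=; try lra.
by apply: F_ge.
Qed.

Let F_ge1 t : 1 <= t -> F t = 1.
Proof.
move=> t1; apply/eqP; rewrite eq_le -{1}(@G_ge1 (t + 1)) ?F_le//=; try lra.
by apply: F_ge => u tu; rewrite G_ge1//; lra.
Qed.

Let F_Ny : F t @[t --> -oo] --> (0 : R).
Proof.
apply/cvgrPdist_le => e e0; near=> t; have t0 : t < 0; last by rewrite F_lt0// subrr normr0 ltW.
by near: t; exact: nbhs_ninfty_lt.
Unshelve. all: by end_near. Qed.

Let F_y : F t @[t --> +oo] --> (1 : R).
Proof.
apply/cvgrPdist_le => e e0; near=> t; have t0 : 1 < t; last by rewrite (F_ge1 (ltW t0)) subrr normr0 ltW.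
by near: t; exact: nbhs_pinfty_gt.
Unshelve. all: by end_near. Qed.

HB.instance Definition _ := isCumulative.Build R _ R F F_nd F_rc.
HB.instance Definition _ := isCumulativeBounded.Build R 0 1 F F_Ny F_y.

Let P : probability (measurableTypeR R) R := lebesgue_stieltjes_measure F.

Let P_le u : P [set` `]-oo, u]] = (F u)%:E.
Proof. by rewrite -cdf_lebesgue_stieltjes_id. Qed.

Let P_out : P (~` [set` `]-1, 1]]) = 0%E.
Proof.
have -> : ~` [set` `]-1, 1]] = [set` `]-oo, -1]] `|` ~` [set` `]-oo, (1 : R)]].
  apply/seteqP; split=> t /=; rewrite !in_itv/=.
    by move=> /negP; rewrite negb_and -leNgt => /orP[|/negP]; [left|right].
  move=> [t1|/negP t1]; first by rewrite ltNge t1.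
  by apply/negP; rewrite negb_and t1 orbT.
apply/eqP; rewrite eq_le measure_ge0 andbT.
have m1 : measurable ([set` `]-oo, -1]] : set (measurableTypeR R)).
  exact: measurable_itv.
have m2 : measurable ([set` `]-oo, 1]] : set (measurableTypeR R)).
  exact: measurable_itv.
apply: le_trans (measureU2 _ m1 (measurableC m2)) _.
have P1 : P [set` `]-oo, -1]] = 0%E by rewrite P_le F_lt0// oppr_lt0.
have P2 : P (~` [set` `]-oo, 1]]) = 0%E.
  by apply: etrans (probability_setC P m2) _; rewrite P_le F_ge1// subee.
have le0 (x : \bar R) : x = 0%E -> (x <= 0)%E by move=> ->.
by apply: le_trans (leeD (le0 _ P1) (le0 _ P2)) _; rewrite adde0.
Qed.

Let bm (h : R -> R) :=
  measurable_fun [set: measurableTypeR R] h /\ exists C, forall t, `|h t| <= C.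

Let bm_integrable h : bm h -> P.-integrable setT (EFin \o h).
Proof.
move=> [mh [C hC]]; apply: measurable_bounded_integrable => //.
  by rewrite (le_lt_trans (probability_le1 _ _))// ltry.
exists C; split; first exact: num_real.
by move=> C' CC' t /= _; apply: le_trans (hC t) (ltW CC').
Qed.

Let bmD h k : bm h -> bm k -> bm (fun t => h t + k t).
Proof.
move=> [mh [C hC]] [mk [D kD]]; split; first exact: measurable_funD.
by exists (C + D) => t; rewrite (le_trans (ler_normD _ _))// lerD.
Qed.

Let bmZ a h : bm h -> bm (fun t => a * h t).
Proof.
move=> [mh [C hC]]; split; first by apply: measurable_funM.
by exists (`|a| * C) => t; rewrite normrM ler_wpM2l.
Qed.

Let indE u : ind u = \1_[set` `]-oo, u]].
Proof. by apply/funext => t; rewrite /ind indicE mem_setE in_itv. Qed.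

Let bm_ind u : bm (ind u).
Proof.
split; last by exists 1 => t; rewrite /ind; case: (t <= u); rewrite ?normr1 ?normr0.
by rewrite indE; apply: measurable_indic; exact: measurable_itv.
Qed.

Let E h := \int[P]_t h t.

Let E_ind u : E (ind u) = F u.
Proof.
rewrite /E /Rintegral; under eq_integral do rewrite indE.
rewrite integral_indic//.
by rewrite setIT -[RHS]/(fine (F u)%:E); congr fine; exact: P_le.
Qed.

Let E_ge0 h : bm h -> (forall t, -1 < t <= 1 -> 0 <= h t) -> 0 <= E h.
Proof.
move=> bh h0; rewrite /E /Rintegral.
rewrite (negligible_integral _ _ (bm_integrable bh) P_out)//; last first.
  by apply: measurableC; exact: measurable_itv.
apply: fine_ge0; apply: integral_ge0 => t /= [_ /contrapT].
by rewrite in_itv/= lee_fin => /h0.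
Qed.

Lemma functional_eq_integral h : continuous h -> (exists C, forall t, `|h t| <= C) ->
  \int[P]_t h t = M h.
Proof.
move=> ch bh; apply/eqP; rewrite -subr_eq0 -normr_le0; apply/ler_addgt0Pr => e e0.
(* One third for each of the two Riemann sums, and one for the gap between them. *)
rewrite add0r; have e3 : 0 < e / 3 by rewrite divr_gt0.
have [dl dl0 dlP] := compact_unif_continuous (@segment_compact R (-1) 1)
  (fun x _ => ch x) e3.
pose N := (Num.truncn (2 / dl)).+1.
have N0 : 0 < N%:R :> R by rewrite ltr0n.
have Ndl : 2 / N%:R < dl.
  by rewrite ltr_pdivrMr// mulrC -ltr_pdivrMr//; exact: truncnS_gt.
have Np : (0 < N)%N by [].
clearbody N.
have osc s t : -1 <= s <= 1 -> -1 <= t <= 1 -> `|s - t| <= 2 / N%:R ->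
    `|h s - h t| <= e / 3.
  by move=> s1 _ st; rewrite ltW// dlP//= ?in_itv//= (le_lt_trans st).
have bmh : bm h by split=> //; exact: continuous_measurable_fun.
have bdh : bdd h by case: bh => C hC; exists C.
have E_D f g : bm f -> bm g -> E (fun t => f t + g t) = E f + E g.
  by move=> bf bg; apply: RintegralD => //; exact: bm_integrable.
have E_Z a f : bm f -> E (fun t => a * f t) = a * E f.
  by move=> bf; apply: RintegralZl => //; exact: bm_integrable.
have E1 : E (ind 1) = 1 by rewrite E_ind F_ge1.
have M_ge0' f : bdd f -> (forall t, -1 < t <= 1 -> 0 <= f t) -> 0 <= M f.
  by move=> bf f0; apply: M_ge0 => // t t01; apply: f0; lra.
have H1 := functional_riemann_sum bmD bmZ bm_ind E_D E_Z E_ge0 E1 Np bmh (ltW e3) osc.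
have H2 := functional_riemann_sum bddD bddZ bdd_ind MD MZ M_ge0' (G_ge1 (lexx _))
  Np bdh (ltW e3) osc.
pose D i := F (node N i) - G (node N i).
have D0 i : 0 <= D i by rewrite subr_ge0.
have nodeS i : node N i.+1 = node N i + 2 / N%:R.
  by rewrite /node -natr1; field; rewrite gt_eqF.
(* The right-hand sides telescope, so the defects [D i] add up to at most 1 whatever [N] is. *)
have DS i : D i <= G (node N i.+1) - G (node N i).
  by rewrite lerD2r F_le// nodeS ltrDl divr_gt0.
have n0 : node N 0 = -1 by rewrite /node mulr0 mul0r addr0.
have nN : node N N = 1 by rewrite /node mulfK ?gt_eqF//; ring.
have node_itv i : (i <= N)%N -> -1 <= node N i <= 1.
  move=> iN; have : 0 <= (i%:R / N%:R : R) <= 1.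
    by rewrite divr_ge0 ?ler0n//= ler_pdivrMr// mul1r ler_nat.
  by rewrite /node -mulrA; lra.
have D00 : D 0%N = 0 by rewrite /D n0 F_lt0 ?G_lt0 ?subrr// oppr_lt0.
have DN : D N = 0 by rewrite /D nN F_ge1 ?G_ge1 ?subrr.
(* Abel summation moves the differences onto [h], whose increments are small. *)
have abel : \sum_(i < N) h (node N i.+1) * (F (node N i.+1) - F (node N i)) -
    \sum_(i < N) h (node N i.+1) * (G (node N i.+1) - G (node N i)) =
    \sum_(i < N) (h (node N i) - h (node N i.+1)) * D i.
  rewrite -sumrB; apply/eqP; rewrite -subr_eq0 -sumrB.
  rewrite (eq_bigr (fun i : 'I_N => h (node N i.+1) * D i.+1 - h (node N i) * D i)); last first.
    by move=> i _; rewrite /D; ring.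
  rewrite -(big_mkord predT (fun i => h (node N i.+1) * D i.+1 - h (node N i) * D i)).
  by rewrite (telescope_sumr (fun i => h (node N i) * D i))// D00 DN !mulr0 subrr.
have H3 : `|\sum_(i < N) (h (node N i) - h (node N i.+1)) * D i| <= e / 3.
  apply: le_trans (ler_norm_sum _ _ _) _.
  apply: (@le_trans _ _ (\sum_(i < N) e / 3 * (G (node N i.+1) - G (node N i)))).
    apply: ler_sum => i _; rewrite normrM [`|D i|]ger0_norm//.
    apply: ler_pM => //; apply: osc.
    - by apply: node_itv; rewrite ltnW.
    - exact: node_itv.
    - by rewrite nodeS opprD addrA subrr sub0r normrN ger0_norm// divr_ge0 ?ltW.
  rewrite -mulr_sumr -(big_mkord predT (fun i => G (node N i.+1) - G (node N i))).
  rewrite (telescope_sumr (fun i => G (node N i)))// n0 nN G_ge1// G_lt0 ?oppr_lt0//.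
  by rewrite subr0 mulr1.
have E2 : \sum_(i < N) h (node N i.+1) * (E (ind (node N i.+1)) - E (ind (node N i))) =
    \sum_(i < N) h (node N i.+1) * (F (node N i.+1) - F (node N i)).
  by apply: eq_bigr => i _; rewrite !E_ind.
move: H1 H2 H3; rewrite -abel E2 -/N -/(E h).
set x := E h; set y := M h; set s := \sum_(i < N) _; set s' := \sum_(i < N) _.
have -> : s' = \sum_(i < N) h (node N i.+1) * (G (node N i.+1) - G (node N i)) by [].
by rewrite !ler_norml => ? ? ?; lra.
Qed.

Theorem positive_functional_measure :
  exists P : probability (measurableTypeR R) R,
  forall h, continuous h -> (exists C, forall t, `|h t| <= C) ->
  \int[P]_t h t = M h.
Proof. by exists P; exact: functional_eq_integral. Qed.

End RieszUnitInterval.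

(** * Compactness, periodicity and measurability on the torus *)

Section Torus.
Context {R : realType} {d : nat}.
Implicit Types (x v : 'rV[R]_d).

Definition box (a b : R) : set 'rV[R]_d := [set x | forall i, a <= x ord0 i <= b].

Lemma compact_box a b : compact (box a b).
Proof.
have -> : box a b = [set x : 'rV[R]_d | forall i, [set` `[a, b]] (x ord0 i)].
  by apply/seteqP; split=> x h i; have := h i; rewrite /= in_itv.
by apply: (@rV_compact R d (fun=> [set` `[a, b]])) => i; exact: segment_compact.
Qed.

Lemma coord_le_norm v i : `|v ord0 i| <= `|v|.
Proof.
rewrite [leRHS]/Num.norm/= mx_normrE.
by rewrite (le_trans _ (le_bigmax _ _ (ord0, i))).
Qed.

Lemma norm_le_coord v r : 0 <= r -> (forall i, `|v ord0 i| <= r) -> `|v| <= r.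
Proof.
move=> r0 h; rewrite [leLHS]/Num.norm/= mx_normrE.
by apply: bigmax_le => // -[i j] _ /=; rewrite ord1.
Qed.

Lemma box_norm r v : 0 <= r -> box (- r) r v <-> `|v| <= r.
Proof.
move=> r0; split=> [bv|vr i].
  by apply: norm_le_coord => // i; rewrite ler_norml.
by rewrite -ler_norml (le_trans (coord_le_norm _ _)).
Qed.

Lemma dotvv_ge0 v : 0 <= dotv v v.
Proof. by apply: sumr_ge0 => i _; rewrite -expr2 sqr_ge0. Qed.

Lemma norm_le_enorm v : `|v| <= enorm v.
Proof.
apply: norm_le_coord; first exact: sqrtr_ge0.
move=> i; rewrite /enorm -sqrtr_sqr ler_sqrt ?dotvv_ge0//.
rewrite /dotv (bigD1 i)//= -expr2 lerDl.
by apply: sumr_ge0 => j _; rewrite -expr2 sqr_ge0.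
Qed.

Lemma sqr_norm_le_dotv v : `|v| ^+ 2 <= dotv v v.
Proof.
rewrite -(sqr_sqrtr (dotvv_ge0 v)) lerXn2r ?nnegrE ?sqrtr_ge0//.
exact: norm_le_enorm.
Qed.

Lemma dotv_le_sqr_norm v : dotv v v <= d%:R * `|v| ^+ 2.
Proof.
rewrite /dotv (le_trans (ler_sum _ (G := fun=> `|v| ^+ 2) _))//; last first.
  by rewrite sumr_const card_ord mulr_natl.
move=> i _; rewrite -expr2 -real_normK ?num_real// lerXn2r ?nnegrE//.
exact: coord_le_norm.
Qed.

Lemma periodic_box x : exists k : 'rV[int]_d, box 0 1 (x + int_shift k).
Proof.
exists (\row_i - Num.floor (x ord0 i)) => i; rewrite !mxE.
have := floor_le (x ord0 i); have := floorD1_gt (x ord0 i).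
by rewrite intrD mulrNz; lra.
Qed.

Lemma periodic_EVT_min (f : 'rV[R]_d -> R) : continuous f -> Defs.periodic f ->
  exists x0, forall x, f x0 <= f x.
Proof.
move=> cf pf.
have [||x0 _ x0P] := @compact_EVT_min _ R f _ _ (@compact_box 0 1).
- by exists 0 => i; rewrite mxE lexx ler01.
- exact: continuous_subspaceT.
exists x0 => x; have [k xk] := periodic_box x.
by rewrite -(pf x k); apply: x0P; rewrite inE.
Qed.

Lemma periodic_bounded (f : 'rV[R]_d -> R) : continuous f -> Defs.periodic f ->
  exists2 C, 0 <= C & forall x, `|f x| <= C.
Proof.
move=> cf pf; have [a aP] := periodic_EVT_min cf pf.
have [||b bP] := @periodic_EVT_min (fun x => - f x).
- by move=> x; apply: continuousN; exact: cf.
- by move=> x k; rewrite pf.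
exists (`|f a| + `|f b|); first by rewrite addr_ge0.
move=> x; rewrite ler_norml; apply/andP; split.
  rewrite (le_trans _ (aP x))// lerNl (le_trans (ler_norm _))// normrN.
  by rewrite lerDl.
by have := bP x; rewrite lerN2 => /le_trans; apply; rewrite (le_trans (ler_norm _))// lerDr.
Qed.

Lemma periodic_unif_continuous (f : 'rV[R]_d -> R) : continuous f -> Defs.periodic f ->
  forall e : R, 0 < e -> exists2 dl : R, 0 < dl &
    forall x y, `|x - y| < dl -> `|f x - f y| < e.
Proof.
move=> cf pf e e0.
have [dl dl0 dlP] := compact_unif_continuous (@compact_box 0 1) (fun x _ => cf x) e0.
exists dl => // x y xy; have [k xk] := periodic_box x.
rewrite -(pf x k) -(pf y k); apply: dlP => //.
by rewrite opprD addrACA subrr addr0.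
Qed.

Lemma prod_normE {V W : normedModType R} (z : V * W) : `|z| = Num.max `|z.1| `|z.2|.
Proof. by []. Qed.

Lemma rat_row_approx x e : 0 < e ->
  exists q : 'rV[rat]_d, `|x - map_mx ratr q| < e.
Proof.
move=> e0.
have /choice[q qP] : forall i, exists r : rat, `|x ord0 i - ratr r| <= e / 2.
  move=> i; have [r] := @rat_in_itvoo R (x ord0 i - e / 2) (x ord0 i + e / 2) ltac:(lra).
  by rewrite in_itv/= => ?; exists r; rewrite ler_norml; lra.
exists (\row_i q i); apply: (@le_lt_trans _ _ (e / 2)); last lra.
by apply: norm_le_coord; [lra|move=> i; rewrite !mxE].
Qed.

Lemma countable_bigcup_measurable {dd} {T : measurableType dd} {I : countType}
    (D : set I) (F : I -> set T) :
  (forall i, D i -> measurable (F i)) -> measurable (\bigcup_(i in D) F i).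
Proof.
move=> mF.
pose E n := if unpickle n is Some i then if `[< D i >] then F i else set0 else set0.
have -> : \bigcup_(i in D) F i = \bigcup_n E n.
  apply/seteqP; split=> t.
    by move=> [i Di Fi]; exists (pickle i) => //; rewrite /E pickleK asboolT.
  by move=> [n _]; rewrite /E; case: unpickle => // i; case: asboolP => // Di; exists i.
apply: bigcup_measurable => n _; rewrite /E; case: unpickle => [i|]; last exact: measurable0.
by case: asboolP => [/mF//|_]; exact: measurable0.
Qed.

Lemma measurable_ball_rowt (q : 'rV[R]_d) e :
  measurable [set t : d.-tuple R | `|rowt t - q| < e].
Proof.
have [e0|e0] := ltP 0 e; last first.
  rewrite (_ : [set _ | _] = set0)//; apply/seteqP; split=> // t /=.
  by move=> /(le_lt_trans (normr_ge0 _)); rewrite ltNge e0.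
have -> : [set t : d.-tuple R | `|rowt t - q| < e] =
    \bigcap_(i in [set: 'I_d]) (@tnth d R ^~ i @^-1` [set r | `|r - q ord0 i| < e]).
  apply/seteqP; split=> t /=.
    move=> te i _ /=; apply: le_lt_trans te.
    by have := coord_le_norm (rowt t - q) i; rewrite !mxE.
  move=> h; rewrite [ltLHS]/Num.norm/= mx_normrE.
  by apply: bigmax_lt => // -[i j] _ /=; rewrite ord1 !mxE; exact: h.
apply: fin_bigcap_measurable; first exact: finite_finset.
move=> i _; rewrite -[X in measurable X]setTI; apply: measurable_tnth => //.
rewrite (_ : [set _ | _] = [set` `]q ord0 i - e, q ord0 i + e[]); last first.
  by apply/seteqP; split=> r /=; rewrite in_itv/= ltr_norml; lra.
exact: measurable_itv.
Qed.

(** The sigma-algebra on tuples is generated by the coordinates, whereas [f] is continuous for the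
    sup norm on rows. The link is that the preimage of an open half-line is a countable union of
    products of balls with rational centres and radii [1 / (m + 1)]. *)
Lemma measurable_continuous_pair (f : 'rV[R]_d * 'rV[R]_d -> R) : continuous f ->
  measurable_fun [set: d.-tuple R * d.-tuple R] (fun z => f (rowt z.1, rowt z.2)).
Proof.
move=> cf mT; apply: (measurability _ (RGenOInfty.measurableE R)) => //.
move=> _ [_ [a ->] <-]; rewrite setTI.
pose U (c : 'rV[rat]_d * 'rV[rat]_d * nat) : set (d.-tuple R * d.-tuple R) :=
  [set t | `|rowt t - map_mx ratr c.1.1| < c.2.+1%:R^-1] `*`
  [set t | `|rowt t - map_mx ratr c.1.2| < c.2.+1%:R^-1].
pose D := [set c | U c `<=` [set z | a < f (rowt z.1, rowt z.2)]].
rewrite [X in measurable X](_ : _ = \bigcup_(c in D) U c).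
  apply: countable_bigcup_measurable => c _.
  by apply: measurableX; exact: measurable_ball_rowt.
apply/seteqP; split=> [[x v]/=|z [c Dc /Dc]]; last by rewrite /= in_itv/= andbT.
rewrite in_itv/= andbT => afx.
have [e e0 eP] := (continuous_epsP f (rowt x, rowt v)).1 (cf _) (f (rowt x, rowt v) - a)
  ltac:(by rewrite subr_gt0).
pose m := Num.truncn (2 / e).
have m0 : 0 < m.+1%:R^-1 :> R by rewrite invr_gt0.
have me : 2 * m.+1%:R^-1 < e by rewrite ltr_pdivrMr// mulrC -ltr_pdivrMr// truncnS_gt.
have [q qx] := rat_row_approx (rowt x) m0; have [q' qv] := rat_row_approx (rowt v) m0.
exists (q, q', m) => //; move=> [y w] /= [yq wq].
have H : `|(rowt x, rowt v) - (rowt y, rowt w)| < e.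
  apply: le_lt_trans me; rewrite prod_normE ge_max mulr_natl mulr2n.
  apply/andP; split; rewrite /=.
    by rewrite -(subrKA (map_mx ratr q)) (le_trans (ler_normD _ _))// lerD ?ltW//= distrC.
  by rewrite -(subrKA (map_mx ratr q')) (le_trans (ler_normD _ _))// lerD ?ltW//= distrC.
by have := eP _ H; rewrite ltr_norml; lra.
Qed.

End Torus.

(** * C^1 functions on the torus and their differentials *)

Section TestFunctions.
Context {R : realType} {d : nat}.
Implicit Types (x v : 'rV[R]_d) (psi chi : 'rV[R]_d -> R).

Definition test_function psi := C1 psi /\ Defs.periodic psi.

Lemma diff_coord psi x v : differentiable psi x ->
  'd psi x v = \sum_i v ord0 i * 'D_(delta_mx ord0 i) psi x.
Proof.
move=> dp; rewrite {1}(row_sum_delta v) linear_sum.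
by apply: eq_bigr => i _; rewrite linearZ /= deriveE.
Qed.

Lemma diff_periodic psi x k v : test_function psi ->
  'd psi (x + int_shift k) v = 'd psi x v.
Proof.
move=> [[dp _] pp].
apply: etrans (esym (deriveE v (dp (x + int_shift k)))) _.
apply: etrans _ (deriveE v (dp x)); rewrite /derive.
apply: (congr1 (fun g : R -> R => lim (g h @[h --> 0^']))).
by apply/funext => h /=; rewrite addrA !pp.
Qed.

Lemma continuous_diff_pair psi : test_function psi ->
  continuous (fun z : 'rV[R]_d * 'rV[R]_d => 'd psi (z.1) (z.2)).
Proof.
move=> [[dp cp] _].
have -> : (fun z : 'rV[R]_d * 'rV[R]_d => 'd psi (z.1) (z.2)) =
    \sum_i (fun z : 'rV[R]_d * 'rV[R]_d =>
              z.2 ord0 i * 'D_(delta_mx ord0 i) psi (z.1)).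
  by apply/funext => z; rewrite diff_coord// fct_sumE.
move=> z; apply: (big_ind (fun f : 'rV[R]_d * 'rV[R]_d -> R => {for z, continuous f})).
- exact: cst_continuous.
- by move=> f g cf cg; exact: continuousD.
- move=> i _.
  have c2 : {for z, continuous (fun z : 'rV[R]_d * 'rV[R]_d => z.2 ord0 i)}.
    apply: (@continuous_comp _ _ _ (@snd _ _) (fun v : 'rV[R]_d => v ord0 i)).
      exact: cvg_snd.
    exact: coord_continuous.
  have c1 : {for z, continuous (fun z : 'rV[R]_d * 'rV[R]_d =>
      'D_(delta_mx ord0 i) psi (z.1))}.
    apply: (@continuous_comp _ _ _ (@fst _ _)
      (fun x : 'rV[R]_d => 'D_(delta_mx ord0 i) psi x)); first exact: cvg_fst.
    exact: cp.
  exact: cvgM c2 c1.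
Qed.

(* Sealed copy of the differential: unfolding ['d] makes unification diverge. *)
Fact sealed_diff : {D : ('rV[R]_d -> R) -> 'rV[R]_d -> 'rV[R]_d -> R |
  forall psi x v, D psi x v = 'd psi x v}.
Proof. by exists (fun psi x v => 'd psi x v). Qed.

Definition tdiff := sval sealed_diff.

Lemma tdiffE psi x v : tdiff psi x v = 'd psi x v.
Proof. exact: (svalP sealed_diff). Qed.

Lemma tdiff_periodic psi x k v : test_function psi ->
  tdiff psi (x + int_shift k) v = tdiff psi x v.
Proof. by rewrite !tdiffE; exact: diff_periodic. Qed.

Lemma continuous_tdiff psi : test_function psi ->
  continuous (fun z : 'rV[R]_d * 'rV[R]_d => tdiff psi z.1 z.2).
Proof.
move=> /continuous_diff_pair.
by under [X in _ -> continuous X]eq_fun do rewrite tdiffE.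
Qed.

Lemma tdiffr0 psi x : tdiff psi x 0 = 0.
Proof. by rewrite tdiffE linear0. Qed.

Lemma tdiffZr psi x a v : tdiff psi x (a *: v) = a * tdiff psi x v.
Proof. by rewrite !tdiffE linearZ. Qed.

Lemma test_function0 : test_function (fun=> 0).
Proof.
split=> //; split=> [x|i x]; first exact: differentiable_cst.
rewrite (_ : (fun _ => _) = fun=> 0); first exact: cst_continuous.
by apply/funext => y; rewrite derive_cst.
Qed.

Lemma tdiff_cst0 x v : tdiff (fun=> 0) x v = 0.
Proof. by rewrite tdiffE diff_cst. Qed.

Lemma test_functionD psi chi : test_function psi -> test_function chi ->
  test_function (fun x => psi x + chi x) /\
  forall x v, tdiff (fun x => psi x + chi x) x v = tdiff psi x v + tdiff chi x v.
Proof.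
move=> [[dp cp] pp] [[dc cc] pc].
split; last by move=> x v; rewrite 3!tdiffE (diffD (dp x) (dc x)).
split; last by move=> x k; rewrite pp pc.
split=> [x|i]; first exact: differentiableD.
have -> : (fun x => 'D_(delta_mx ord0 i) (fun x => psi x + chi x) x) =
    (fun x => 'D_(delta_mx ord0 i) psi x + 'D_(delta_mx ord0 i) chi x).
  by apply/funext => x; rewrite deriveD//; apply: diff_derivable.
by move=> x; exact: (cvgD (cp i x) (cc i x)).
Qed.

Lemma test_functionZ (a : R) psi : test_function psi ->
  test_function (fun x => a * psi x) /\
  forall x v, tdiff (fun x => a * psi x) x v = a * tdiff psi x v.
Proof.
move=> [[dp cp] pp].
split; last by move=> x v; rewrite !tdiffE (diffZ a (dp x)).
split; last by move=> x k; rewrite pp.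
split=> [x|i]; first exact: differentiableZ.
have -> : (fun x => 'D_(delta_mx ord0 i) (fun x => a * psi x) x) =
    (fun x => a * 'D_(delta_mx ord0 i) psi x).
  by apply/funext => x; rewrite [LHS](deriveZ a)//; apply: diff_derivable.
by move=> x; exact: (cvgM (cvg_cst a) (cp i x)).
Qed.

End TestFunctions.

(** * Separation of a convex cone from the positive functions *)

Section ConeFunctional.
Context {R : realType}.

Let bdd (h : R -> R) := exists C, forall t, 0 <= t <= 1 -> `|h t| <= C.

Variable N : set (R -> R).
Hypothesis N0 : N (fun=> 0).
Hypothesis ND : forall m n, N m -> N n -> N (fun t => m t + n t).
Hypothesis NZ : forall a n, 0 < a -> N n -> N (fun t => a * n t).
Hypothesis Nbdd : forall n, N n -> bdd n.
Hypothesis Ninf : forall n e, N n -> 0 < e -> exists2 t, 0 <= t <= 1 & n t <= e.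

Let S h := [set s : R | exists2 n, N n & forall t, 0 <= t <= 1 -> h t - n t <= s].

(** Hahn-Banach is applied to the gauge [p h], the infimum of [S h]. [Ninf] keeps it finite; it is
    nonpositive on [N] and on nonpositive functions, and at most [a] at the constant [a]. The bounds
    for [-1] and [1] force [M 1 = 1]. *)
Lemma cone_functional : exists M : (R -> R) -> R,
  [/\ forall h k, bdd h -> bdd k -> M (fun t => h t + k t) = M h + M k,
      forall a h, bdd h -> M (fun t => a * h t) = a * M h,
      forall h, bdd h -> (forall t, 0 <= t <= 1 -> 0 <= h t) -> 0 <= M h,
      M (fun=> 1) = 1 & forall n, N n -> M n <= 0].
Proof.
pose p h := inf (S h).
have lbS h : bdd h -> has_lbound (S h).
  move=> [C hC]; exists (- C - 1) => s [n Nn ns].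
  have [t t01 nt] := Ninf Nn ltr01.
  by have := ns t t01; have := hC t t01; rewrite ler_norml; lra.
have p_le h s : bdd h -> S h s -> p h <= s by move=> bh Ss; exact: ge_inf (lbS _ bh) _ Ss.
have p_ge h c : bdd h -> (forall s, S h s -> c <= s) -> c <= p h.
  move=> [C hC] cs; apply: lb_le_inf => //; exists C, (fun=> 0) => // t t01.
  by have := hC t t01; rewrite ler_norml subr0; lra.
have bddD h k : bdd h -> bdd k -> bdd (fun t => h t + k t).
  move=> [C hC] [D kD]; exists (C + D) => t t01.
  by rewrite (le_trans (ler_normD _ _))// lerD ?hC ?kD.
have bddZ a h : bdd h -> bdd (fun t => a * h t).
  move=> [C hC]; exists (`|a| * C) => t t01.
  by rewrite normrM ler_wpM2l// hC.
have bdd1 a : bdd (fun=> a) by exists `|a|.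
have sp : @sublinear_on R (R -> R^o) bdd p.
  split=> [h k bh bk|a h].
    rewrite -lerBlDr; apply: (p_ge _ _ bh) => s [m Nm ms].
    rewrite lerBlDl -lerBlDr; apply: (p_ge _ _ bk) => s' [n Nn ns'].
    rewrite lerBlDr; apply: p_le; first exact: bddD.
    exists (fun t => m t + n t); first exact: ND.
    by move=> t t01; have := ms t t01; have := ns' t t01; rewrite -[(h + k) t]/(h t + k t); lra.
  rewrite le_eqVlt => /orP[/eqP <- bh|a0 bh].
    rewrite mul0r; apply: p_le; first exact: (bddZ 0 h).
    by exists (fun=> 0) => // t _; rewrite -[(0 *: h) t]/(0 * h t) mul0r subr0.
  rewrite mulrC -ler_pdivrMr//; apply: (p_ge _ _ bh) => s [n Nn ns].
  rewrite ler_pdivrMr//; apply: p_le; first exact: (bddZ a h).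
  exists (fun t => a * n t); first exact: NZ.
  move=> t t01; rewrite -[(a *: h) t]/(a * h t) -mulrBr mulrC ler_pM2r//.
  exact: ns.
have [M [MD MZ Mp]] := @Hahn_Banach R (R -> R^o) bdd bddD bddZ p sp.
have pN h : bdd h -> (forall t, 0 <= t <= 1 -> h t <= 0) -> M h <= 0.
  move=> bh h0; apply: le_trans (Mp _ bh) _; apply: p_le => //.
  by exists (fun=> 0) => // t t01; rewrite subr0 h0.
have p1 a : M (fun=> a) <= a.
  apply: le_trans (Mp _ (bdd1 a)) _; apply: p_le => //.
  by exists (fun=> 0) => // t t01; rewrite subr0.
exists M; split=> [h k|a h|h bh h0||n Nn].
- exact: MD.
- exact: MZ.
- have : M (fun t => -1 * h t) <= 0.
    by apply: pN; [exact: bddZ|move=> t /h0; lra].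
  by rewrite [M _](MZ (-1) h bh); lra.
- apply/eqP; rewrite eq_le p1/=.
  have := p1 (-1); have -> : (fun=> -1) = (fun t : R => -1 * (1 : R)).
    by apply/funext => t; rewrite mulr1.
  by rewrite [M _](MZ (-1) (fun=> 1) (bdd1 1)); lra.
- apply: le_trans (Mp _ (Nbdd Nn)) _; apply: p_le; first exact: Nbdd.
  by exists n => // t _; rewrite subrr.
Qed.

End ConeFunctional.

(** * Bounds on the Lagrangian and the critical value as a supremum *)

Section Lagrangian.
Context {R : realType} {d : nat} (L : 'rV[R]_d -> 'rV[R]_d -> R).
Hypothesis cL : continuous (fun xv : 'rV[R]_d * 'rV[R]_d => L xv.1 xv.2).
Hypothesis pL : periodic_lagrangian L.
Hypothesis sL : superlinear L.

Let compact_K r : compact (@box R d 0 1 `*` @box R d (- r) r).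
Proof. by apply: compact_setX; exact: compact_box. Qed.

Lemma lagrangian_le (r : R) : 0 <= r -> exists C, forall x v, `|v| <= r -> L x v <= C.
Proof.
move=> r0; have [|[x0 v0] _ h] := compact_EVT_max _ (@compact_K r)
    (continuous_subspaceT cL).
  by exists (0, 0); split=> i /=; rewrite mxE ?lexx ?ler01// oppr_le0 r0.
exists (L x0 v0) => x v /(box_norm _ r0) bv; have [k xk] := periodic_box x.
by rewrite -(pL x v k); apply: (h (_, _)); rewrite inE.
Qed.

Lemma lagrangian_ge : exists m, forall x v, m <= L x v.
Proof.
have [r1 r1P] := sL 0; pose r := Num.max 0 r1.
have r0 : 0 <= r by rewrite le_max lexx.
have [|[x0 v0] _ h] := compact_EVT_min _ (@compact_K r) (continuous_subspaceT cL).
  by exists (0, 0); split=> i /=; rewrite mxE ?lexx ?ler01// oppr_le0 r0.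
exists (Num.min 0 (L x0 v0)) => x v; have [vr|rv] := leP `|v| r.
  have /(box_norm _ r0) bv := vr; have [k xk] := periodic_box x.
  rewrite ge_min -(pL x v k); apply/orP; right.
  by apply: (h (_, _)); rewrite inE.
rewrite ge_min -(mul0r (enorm v)) r1P// (le_lt_trans _ (lt_le_trans rv (norm_le_enorm v)))//.
by rewrite le_max lexx orbT.
Qed.

Lemma lagrangian_unif_continuous (r e : R) : 0 <= r -> 0 < e -> exists2 dl : R, 0 < dl &
  forall x y v, `|v| <= r -> `|x - y| < dl -> `|L x v - L y v| < e.
Proof.
move=> r0 e0.
have [dl dl0 dlP] := compact_unif_continuous (@compact_K r) (fun z _ => @cL z) e0.
exists dl => // x y v /(box_norm _ r0) bv xy; have [k xk] := periodic_box x.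
rewrite -(pL x v k) -(pL y v k).
apply: (dlP (_, v) (_, v)) => //; rewrite prod_normE /= subrr normr0.
by rewrite opprD addrACA subrr addr0 gt_max xy dl0.
Qed.

Definition critical_set : set R :=
  [set l | exists2 psi, test_function psi & forall x v, l <= L x v + tdiff psi x v].

Definition critical_value : R := sup critical_set.

Let has_sup_critical_set : has_sup critical_set.
Proof.
split.
  have [m mL] := lagrangian_ge; exists m, (fun=> 0); first exact: test_function0.
  by move=> x v; rewrite tdiff_cst0 addr0.
(* At zero velocity the differential vanishes, which bounds all [l] at once. *)
exists (L 0 0) => l [psi _ h]; have := h 0 0.
by rewrite tdiffr0 addr0.
Qed.

Lemma critical_value_ub l psi : test_function psi ->
  (forall x v, l <= L x v + tdiff psi x v) -> l <= critical_value.
Proof. by move=> tp h; apply: ub_le_sup; [case: has_sup_critical_set|exists psi]. Qed.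

Lemma critical_value_adherent (e : R) : 0 < e -> exists2 psi, test_function psi &
  forall x v, critical_value - e <= L x v + tdiff psi x v.
Proof.
move=> e0; have [l [psi tp h] le_l] := sup_adherent e0 has_sup_critical_set.
by exists psi => // x v; rewrite (le_trans (ltW le_l)).
Qed.

Lemma critical_value_le l :
  (forall m psi, test_function psi -> (forall x v, m <= L x v + tdiff psi x v) -> m <= l) ->
  critical_value <= l.
Proof.
move=> h; apply: ge_sup; first by case: has_sup_critical_set.
by move=> m [psi]; exact: h.
Qed.

(* A lower bound on the unit ball controls the gradient, so superlinearity
   extends it from a fixed box to all velocities. *)
Lemma superlinear_extend (c_lo c_hi : R) : exists2 r : R, 1 <= r &
  forall psi c, test_function psi -> c_lo <= c <= c_hi ->
  (forall x v, `|v| <= r -> c <= L x v + tdiff psi x v) ->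
  forall x v, c <= L x v + tdiff psi x v.
Proof.
have [C CL] := lagrangian_le ler01.
(* The unit ball gives [tdiff psi x v >= (c - C) * |v|], a loss of at most [|C - c_lo| * |v|]. The
   extra slope 1 leaves [|v|], which exceeds [c_hi] beyond [r]. *)
have [r0 r0P] := sL (`|C - c_lo| + 1).
pose r := Num.max 1 (Num.max r0 c_hi).
have r1 : 1 <= r by rewrite le_max lexx.
exists r => // psi c tp /andP[c1 c2] Hr x v.
have [vr|rv] := leP `|v| r; first exact: Hr.
have v0 : 0 < `|v| by apply: lt_trans rv; rewrite lt_max ltr01.
have nu : `| (`|v|^-1 *: v) | = 1 by rewrite normrZ normfV normr_id mulVf ?gt_eqF.
have Hu : c <= L x (`|v|^-1 *: v) + tdiff psi x (`|v|^-1 *: v) by apply: Hr; rewrite nu.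
have Lu : L x (`|v|^-1 *: v) <= C by apply: CL; rewrite nu.
have dv : (c - C) * `|v| <= tdiff psi x v.
  rewrite -ler_pdivlMr//.
  have E : tdiff psi x (`|v|^-1 *: v) = tdiff psi x v / `|v| by rewrite tdiffZr mulrC.
  by move: Hu Lu; rewrite E; set a := tdiff psi x v / _; set b := L _ _; lra.
have r0v : r0 < enorm v.
  by rewrite (le_lt_trans _ (lt_le_trans rv (norm_le_enorm v)))// !le_max lexx orbT.
have := r0P x v r0v; have := norm_le_enorm v.
have : c_hi < `|v| by apply: le_lt_trans rv; rewrite !le_max lexx !orbT.
have := ler_norm (C - c_lo); have := normr_ge0 (C - c_lo).
by move=> ? ? ? ? ?; nra.
Qed.

(** If the inequality failed for every [x] and [v] in the box, it would extend to all velocities a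
    lower bound above the supremum. One [r] for all [psi] is what allows a single compact box to
    carry the measure. *)
Lemma critical_value_box : exists2 r : R, 1 <= r &
  forall psi (e : R), test_function psi -> 0 < e ->
  exists x v, [/\ box 0 1 x, `|v| <= r & L x v + tdiff psi x v < critical_value + e].
Proof.
set lam := critical_value.
have [r r1 ext] := superlinear_extend lam (lam + 1).
exists r => // psi e tp e0; apply: contrapT => H.
(* The cap keeps [lam + e'] in the range of levels for which [r] was chosen. *)
pose e' := Num.min e 1.
have e'0 : 0 < e' by rewrite lt_min e0 ltr01.
have e'1 : e' <= 1 by rewrite ge_min lexx orbT.
suff : lam + e' <= lam by lra.
apply: (critical_value_ub tp); apply: ext => //; first by apply/andP; split; lra.
move=> x v vr; have [k xk] := periodic_box x.
rewrite -(pL x v k) -(tdiff_periodic x k v tp).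
apply: contrapT => /negP; rewrite -ltNge => h; apply: H.
exists (x + int_shift k), v; split=> //; apply: lt_le_trans h _.
by rewrite lerD2l ge_min lexx.
Qed.

End Lagrangian.

(** * Lower bound for the action and construction of a minimizing measure *)

Section MinimizingMeasure.
Context {R : realType} {d : nat} (L : 'rV[R]_d -> 'rV[R]_d -> R).
Hypothesis cL : continuous (fun xv : 'rV[R]_d * 'rV[R]_d => L xv.1 xv.2).
Hypothesis pL : periodic_lagrangian L.
Hypothesis sL : superlinear L.

(** The action may be infinite. The negative part of [f] is bounded, so if [f] is not integrable its
    integral is [+oo] and the bound is trivial. *)
Lemma centered_le_integral {dd} {T : measurableType dd} (nu : probability T R)
    (f g : T -> R) (c m : R) :
  measurable_fun setT f -> (forall z, m <= f z) ->
  nu.-integrable setT (EFin \o g) -> (\int[nu]_z (g z)%:E = 0)%E ->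
  (forall z, c <= f z + g z) -> (c%:E <= \int[nu]_z (f z)%:E)%E.
Proof.
move=> mf fm ig g0 cfg.
have mef : measurable_fun setT (EFin \o f) by exact/measurable_EFinP.
have cst_int a : (\int[nu]_z (a%:E) = a%:E)%E.
  by rewrite integral_cst//= probability_setT mule1.
have icst a : nu.-integrable setT (fun=> a%:E).
  exact: finite_measure_integrable_cst.
have [fi|nfi] := pselect (nu.-integrable setT (EFin \o f)).
  rewrite -(adde0 (\int[nu]_z (f z)%:E)%E) -g0 -(integralD _ fi ig)// -(cst_int c).
  apply: le_integral => //; first exact: integrableD.
  by move=> z _ /=; rewrite -EFinD lee_fin.
suff -> : (\int[nu]_z (f z)%:E = +oo)%E by rewrite leey.
have neg_le : (\int[nu]_z ((EFin \o f)^\- z) <= `|m|%:E)%E.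
  rewrite -(cst_int `|m|); apply: ge0_le_integral => //.
  - exact: measurable_funeneg.
  - move=> z _; rewrite funenegE ge_max /= !lee_fin normr_ge0 andbT.
    rewrite lerNl (le_trans _ (fm z))// lerNl -normrN; exact: ler_norm.
have pos_oo : (\int[nu]_z ((EFin \o f)^\+ z) = +oo)%E.
  apply/eqP; rewrite -leye_eq leNgt; apply/negP => pos_lt; apply: nfi.
  apply/integrableP; split=> //.
  under eq_integral do rewrite -[X in `|X|%E]/((EFin \o f) _).
  rewrite (eq_integral (fun z => (EFin \o f)^\+ z + (EFin \o f)^\- z))%E; last first.
    by move=> z _; rewrite -[RHS]/(((EFin \o f)^\+ \+ (EFin \o f)^\-)%E z) -fune_abse.
  rewrite ge0_integralD//; [|exact: measurable_funepos|exact: measurable_funeneg].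
  by rewrite lte_add_pinfty// (le_lt_trans neg_le)// ltry.
rewrite integralE pos_oo addye//.
by rewrite -ltNye lteNr /= (le_lt_trans neg_le)// ltry.
Qed.

Theorem holonomic_action_ge (nu : @PM R d) : holonomic nu ->
  ((critical_value L)%:E <= action L nu)%E.
Proof.
move=> [_ hol]; have [m mL] := lagrangian_ge cL pL sL.
apply/lee_addgt0Pr => e e0.
have [psi [C1p pp] psiP] := critical_value_adherent cL pL sL e0.
have [ig g0] := hol psi C1p pp.
rewrite -leeBlDr// -EFinB; apply: (centered_le_integral _ _ ig g0).
- exact: (measurable_continuous_pair cL).
- by move=> z; exact: mL.
- by move=> z; rewrite -tdiffE; exact: psiP.
Qed.

Lemma continuous_row n (u : 'I_n -> R -> R) : (forall i, continuous (u i)) ->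
  continuous (fun t => \row_i u i t).
Proof.
move=> cu t; apply/cvgrPdist_le => e e0.
have : \forall s \near t, forall i, `|u i t - u i s| <= e.
  apply: (@filter_forall R 'I_n (fun i s => `|u i t - u i s| <= e) (nbhs t) _) => i.
  by have /cvgrPdist_le := cu i t; apply.
apply: filterS => s h; apply: norm_le_coord; first exact: ltW.
by move=> i; rewrite !mxE.
Qed.

Lemma continuous_pair {U V W : normedModType R} (f : U -> V) (g : U -> W) :
  continuous f -> continuous g -> continuous (fun t => (f t, g t)).
Proof.
move=> cf cg t; apply/continuous_epsP => e e0.
have [d1 d10 d1P] := (continuous_epsP f t).1 (cf t) e e0.
have [d2 d20 d2P] := (continuous_epsP g t).1 (cg t) e e0.
exists (Num.min d1 d2); first by rewrite lt_min d10.
by move=> s; rewrite lt_min prod_normE gt_max => /andP[/d1P -> /d2P ->].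
Qed.

Theorem minimizing_measure : exists2 mu : @PM R d, holonomic mu &
  (action L mu <= (critical_value L)%:E)%E.
Proof.
have [r r1 boxP] := critical_value_box cL pL sL.
set lam := critical_value L in boxP *.
have r0 : 0 < r by rewrite (lt_le_trans _ r1).
have [G [cG G01 dG]] := @dense_curve R (d + d).
pose X t : 'rV[R]_d := \row_i G (lshift d i) t.
pose V t : 'rV[R]_d := \row_i (r * (2 * G (rshift d i) t - 1)).
have cXV : continuous (fun t => (X t, V t)).
  apply: continuous_pair; first exact: (continuous_row (fun i => cG (lshift d i))).
  apply: (@continuous_row _ (fun i t => r * (2 * G (rshift d i) t - 1))) => i s.
  exact: (cvgM (cvg_cst r) (cvgB (cvgM (cvg_cst (2 : R)) (cG (rshift d i) s)) (cvg_cst (1 : R)))).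
have XV t : box 0 1 (X t) /\ box (- r) r (V t).
  by split=> i; rewrite mxE//; have := G01 (rshift d i) t; nra.
pose C2 (f : 'rV[R]_d * 'rV[R]_d -> R) := continuous f.
have cf f : C2 f -> continuous (fun t => f (X t, V t)).
  move=> c t; apply: (@continuous_comp _ _ _ (fun t => (X t, V t)) f); first exact: cXV.
  exact: c.
have bf f : C2 f -> exists C, forall t, `|f (X t, V t)| <= C.
  move=> c.
  have cK : compact (@box R d 0 1 `*` @box R d (- r) r).
    by apply: compact_setX; exact: compact_box.
  have cN : continuous (fun z => `|f z|).
    by move=> z; apply: (@continuous_comp _ _ _ f (@Num.norm _ R)); [exact: c|exact: norm_continuous].
  have [|z _ zP] := compact_EVT_max _ cK (continuous_subspaceT cN).
    by exists (X 0, V 0); exact: XV.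
  by exists `|f z| => t; apply: (zP (_, _)); rewrite inE; exact: XV.
have dense f x v e : C2 f -> 0 < e -> box 0 1 x -> `|v| <= r ->
    exists2 t, 0 <= t <= 1 & f (X t, V t) < f (x, v) + e.
  move=> c e0 bx vr.
  have [dl dl0 dlP] := (continuous_epsP f (x, v)).1 (c _) _ e0.
  pose z j := match fintype.split (j : 'I_(d + d)) with inl i => x ord0 i | inr i => (v ord0 i / r + 1) / 2 end.
  have z01 j : 0 <= z j <= 1.
    rewrite /z; case: fintype.split => i; first exact: bx.
    have := coord_le_norm v i => /le_trans/(_ vr); rewrite ler_norml => /andP[vr1 vr2].
    have : -1 <= v ord0 i / r <= 1 by rewrite ler_pdivlMr// ler_pdivrMr// mulN1r mul1r vr1.
    by lra.
  (* Velocities are stretched by [2 * r], so this precision becomes [dl / 2]; for positions [1 <= r]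
     gives the same bound. *)
  have [t t01 tP] := dG z (dl / (4 * r)) ltac:(by rewrite divr_gt0// mulr_gt0) z01.
  exists t => //.
  have E : dl / (4 * r) * (4 * r) = dl by rewrite divfK// gt_eqF// mulr_gt0.
  have q0 : 0 < dl / (4 * r) by rewrite divr_gt0// mulr_gt0.
  suff : `|(x, v) - (X t, V t)| < dl by move=> /dlP; rewrite ltr_norml; lra.
  apply: (@le_lt_trans _ _ (dl / 2)); last lra.
  rewrite prod_normE ge_max; apply/andP; split; apply: norm_le_coord => [|i]; try lra.
    rewrite !mxE distrC ltW//; have := tP (lshift d i).
    rewrite /z (unsplitK (inl i)) => /lt_le_trans; apply.
    by move: E q0; set q := dl / _; nra.
  rewrite !mxE distrC; have := tP (rshift d i); rewrite /z (unsplitK (inr i)).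
  rewrite (_ : r * _ - _ = 2 * r * (G (rshift d i) t - (v ord0 i / r + 1) / 2)); last first.
    by field; rewrite gt_eqF.
  rewrite normrM gtr0_norm ?mulr_gt0// => h.
  have : 2 * r * `|G (rshift d i) t - (v ord0 i / r + 1) / 2| <= 2 * r * (dl / (4 * r)).
    by rewrite ler_pM2l ?mulr_gt0// ltW.
  by move: E; set q := dl / _; nra.
(* The cone spanned by [L - lam] and all differentials, seen along the curve. Differentials occur
   with both signs, so a functional that is nonpositive on [N] vanishes on them. *)
pose N : set (R -> R) := [set n | exists a, exists2 psi, test_function psi /\ 0 <= a &
  n = fun t => a * (L (X t) (V t) - lam) + tdiff psi (X t) (V t)].
have cF a psi : test_function psi ->
    C2 (fun z => a * (L z.1 z.2 - lam) + tdiff psi z.1 z.2).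
  move=> tp z.
  have c1 : {for z, continuous (fun z : 'rV[R]_d * 'rV[R]_d => L z.1 z.2 - lam)}.
    exact: (cvgB (@cL z) (cvg_cst lam)).
  have c2 : {for z, continuous (fun z : 'rV[R]_d * 'rV[R]_d => a * (L z.1 z.2 - lam))}.
    exact: (cvgM (cvg_cst a) c1).
  have c3 : {for z, continuous (fun z : 'rV[R]_d * 'rV[R]_d => tdiff psi z.1 z.2)}.
    exact: continuous_tdiff.
  exact: cvgD c2 c3.
have [m mL] := lagrangian_ge cL pL sL.
have [||||| M [MD MZ M0 M1 MN]] := @cone_functional R N.
- exists 0, (fun=> 0); first by split=> //; exact: test_function0.
  by apply/funext => t; rewrite tdiff_cst0 mul0r addr0.
- move=> _ _ [a [psi [tp a0] ->]] [b [chi [tc b0] ->]].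
  have [tpc dpc] := test_functionD tp tc.
  exists (a + b), (fun x => psi x + chi x); first by rewrite addr_ge0.
  apply/funext => t; rewrite (dpc (X t) (V t)).
  by move: (tdiff psi (X t) (V t)) (tdiff chi (X t) (V t)) => p q; ring.
- move=> c _ c0 [a [psi [tp a0] ->]]; have [tcp dcp] := test_functionZ c tp.
  exists (c * a), (fun x => c * psi x); first by rewrite mulr_ge0// ltW.
  apply/funext => t; rewrite (dcp (X t) (V t)).
  by move: (tdiff psi (X t) (V t)) => p; ring.
- move=> _ [a [psi [tp a0] ->]]; have [C CP] := bf _ (cF a psi tp).
  by exists C => t _; exact: CP.
- move=> _ e [a [psi [tp a0] ->]] e0.
  (* As [a] may be 0, [psi] is divided by [a + eta]. Removing the term [eta * (L - lam)] afterwards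
     costs at most [e / 4], thanks to the lower bound [m] of [L]. *)
  pose eta := e / (4 * (`|lam - m| + 1)).
  have den0 : 0 < 4 * (`|lam - m| + 1) by rewrite mulr_gt0// ltr_wpDl.
  have eta0 : 0 < eta by rewrite divr_gt0.
  have etaE : eta * (lam - m) <= e / 4.
    have : eta * (4 * (`|lam - m| + 1)) = e by rewrite divfK// gt_eqF.
    have := ler_norm (lam - m); have := normr_ge0 (lam - m).
    by move: eta0; clear; set q := `|_|; nra.
  have a'0 : 0 < a + eta by rewrite ltr_wpDl.
  have [tq dq] := test_functionZ (a + eta)^-1 tp.
  have [x [v [bx vr]]] := boxP _ _ tq (divr_gt0 e0 (mulr_gt0 (ltr0n R 4) a'0)).
  rewrite (dq x v) => h.
  have h2 : (a + eta) * (L x v - lam) + tdiff psi x v < e / 4.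
    move: a'0 h; set s := a + eta; set q := tdiff psi x v; set l := L x v => s0 h.
    have -> : s * (l - lam) + q = s * (l + s^-1 * q - lam) by field; rewrite gt_eqF.
    have -> : e / 4 = s * (e / (4 * s)) by field; rewrite gt_eqF.
    by rewrite ltr_pM2l// ltrBlDl.
  have [t t01 tP] := dense _ x v (e / 2) (cF a psi tp) (divr_gt0 e0 (ltr0n R 2)) bx vr.
  exists t => //; apply: le_trans (ltW tP) _ => /=.
  have := mL x v; move: h2 etaE eta0; clear -e0.
  set l := L x v; set q := tdiff psi x v; rewrite mulrDl => ? ? ? ?.
  have : eta * (m - l) <= 0 by nra.
  by nra.
have [P PE] := positive_functional_measure MD MZ M0 M1.
(* The curve lives in the closed cube, the measure must live in the half-open one: coordinates equal
   to 1 are folded to 0. This breaks continuity but not measurability, and periodic functions do not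
   see it. *)
pose Phi1 t : d.-tuple R :=
  [tuple (if 1 <= G (lshift d i) t then 0 else G (lshift d i) t) | i < d].
pose Phi2 t : d.-tuple R := [tuple r * (2 * G (rshift d i) t - 1) | i < d].
have mG j : measurable_fun [set: measurableTypeR R] (G j).
  exact: continuous_measurable_fun.
have mPhi : measurable_fun [set: measurableTypeR R] (fun t => (Phi1 t, Phi2 t)).
  apply: measurable_fun_pair; apply/measurable_fun_tnthP => i.
    rewrite (_ : _ \o _ = fun t => if 1 <= G (lshift d i) t then 0 else G (lshift d i) t).
      by apply: measurable_fun_ifT => //; exact: measurable_fun_ler.
    by apply/funext => t /=; rewrite tnth_mktuple.
  rewrite (_ : _ \o _ = fun t => r * (2 * G (rshift d i) t - 1)).
    apply: measurable_funM => //; apply: measurable_funB => //.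
    exact: measurable_funM.
  by apply/funext => t /=; rewrite tnth_mktuple.
pose mu : @PM R d := distribution P (mfun_Sub (mem_set mPhi)).
have V2 t : rowt (Phi2 t) = V t by apply/rowP => i; rewrite !mxE tnth_mktuple.
have X1 t : exists k, X t = rowt (Phi1 t) + int_shift k.
  exists (\row_i (1 <= G (lshift d i) t)%R%:Z); apply/rowP => i.
  rewrite /int_shift !mxE tnth_mktuple.
  have := G01 (lshift d i) t; case: (leP 1 (G (lshift d i) t)) => /= ? ?; last by rewrite addr0.
  by rewrite ?mulr1z; lra.
have muE f : C2 f -> (forall x v k, f (x + int_shift k, v) = f (x, v)) ->
    mu.-integrable setT (fun z => (f (rowt z.1, rowt z.2))%:E) /\
    (\int[mu]_z (f (rowt z.1, rowt z.2))%:E = (M (fun t => f (X t, V t)))%:E)%E.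
  move=> c pf; have [C CP] := bf _ c.
  have fPhi t : f (rowt (Phi1 t), rowt (Phi2 t)) = f (X t, V t).
    by rewrite V2; have [k ->] := X1 t; rewrite pf.
  have mf := measurable_continuous_pair c.
  have iP : P.-integrable setT (fun t => (f (X t, V t))%:E).
    apply: measurable_bounded_integrable => //.
    - by rewrite (le_lt_trans (probability_le1 _ _))// ltry.
    - by apply: continuous_measurable_fun; exact: cf.
    - exists C; split; first exact: num_real.
      by move=> C' CC' t /= _; apply: le_trans (CP t) (ltW CC').
  have iPhi : P.-integrable setT
      ((fun z => (f (rowt z.1, rowt z.2))%:E) \o (fun t => (Phi1 t, Phi2 t))).
    by apply: eq_integrable iP => // t _ /=; rewrite fPhi.
  split; last first.
    rewrite integral_distribution//; last exact/measurable_EFinP.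
    rewrite -(PE _ (cf _ c) (ex_intro _ C CP)) /Rintegral.
    rewrite fineK; last exact: integrable_fin_num.
    by apply: eq_integral => t _ /=; rewrite fPhi.
  by apply: (integrable_pushforward mPhi) => //; exact/measurable_EFinP.
exists mu; first split.
- have E : (fun t => (Phi1 t, Phi2 t)) @^-1` (cube `*` setT) = setT.
    apply/seteqP; split=> // t _; split=> //= i.
    rewrite tnth_mktuple; case: (leP 1 (G (lshift d i) t)) => [_|?]; first by rewrite lexx ltr01.
    by have /andP[-> _] := G01 (lshift d i) t.
  by apply: etrans (congr1 P E) _; exact: probability_setT.
- move=> psi C1p pp; have tp : test_function psi by [].
  have -> : (fun z : d.-tuple R * d.-tuple R => ('d psi (rowt z.1) (rowt z.2))%:E) =
      (fun z => (tdiff psi (rowt z.1) (rowt z.2))%:E).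
    by apply/funext => z; rewrite tdiffE.
  have [||ii Ii] := muE (fun z => tdiff psi z.1 z.2).
  + exact: continuous_tdiff.
  + by move=> x v k; exact: tdiff_periodic.
  split=> //; rewrite Ii; congr (_%:E); apply/eqP; rewrite eq_le; apply/andP; split.
    apply: MN; exists 0, psi => //.
    by apply/funext => t; rewrite mul0r add0r.
  have [tn dn] := test_functionZ (-1) tp.
  have [C CP] := bf _ (continuous_tdiff tp).
  have := MZ (-1) (fun t => tdiff psi (X t) (V t)) (ex_intro _ C (fun t _ => CP t)).
  suff : M (fun t => -1 * tdiff psi (X t) (V t)) <= 0 by lra.
  apply: MN; exists 0, (fun x => -1 * psi x) => //.
  by apply/funext => t; rewrite mul0r add0r (dn (X t) (V t)).
- have [||_ Ii] := muE (fun z => L z.1 z.2).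
  + exact: cL.
  + by move=> x v k; exact: pL.
  rewrite /action Ii lee_fin.
  have [C CP] := bf _ cL.
  have bL : exists C, forall t, 0 <= t <= 1 -> `|L (X t) (V t)| <= C by exists C => t _; exact: CP.
  have bl : exists C, forall t : R, 0 <= t <= 1 -> `|- lam| <= C by exists `|- lam|.
  have := MD _ _ bL bl.
  have -> : M (fun=> - lam) = - lam.
    have b1 : exists C : R, forall t : R, 0 <= t <= 1 -> `|1 : R| <= C.
      by exists 1 => t _; rewrite normr1.
    by have := MZ (- lam) (fun=> 1) b1; rewrite M1 mulr1.
  suff : M (fun t => L (X t) (V t) - lam) <= 0 by lra.
  apply: MN; exists 1, (fun=> 0); first by split=> //; exact: test_function0.
  by apply/funext => t; rewrite tdiff_cst0 mul1r addr0.
Qed.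

End MinimizingMeasure.

(** * Viscosity solutions: touching by test functions and sup-convolution *)

Section Viscosity.
Context {R : realType} {d : nat}.
Implicit Types (x v w : 'rV[R]_d) (phi psi : 'rV[R]_d -> R).

Lemma near_right_prod w (P : R -> 'rV[R]_d -> Prop) (h0 rho : R) :
  0 < h0 -> 0 < rho ->
  (forall h w', 0 < h < h0 -> `|w - w'| < rho -> P h w') ->
  \forall h \near 0^'+ & w' \near w, P h w'.
Proof.
move=> h00 rho0 HP.
exists ([set h : R | 0 < h < h0], ball w rho).
  split; last exact: nbhsx_ballx.
  exists h0 => //= h /=; rewrite sub0r normrN => + h1; rewrite gtr0_norm// => ->.
  by rewrite h1.
by move=> [h w'] [/= ?]; rewrite -ball_normE /= => ?; exact: HP.
Qed.

Lemma dotv_le p w : `|dotv p w| <= (\sum_i `|p ord0 i|) * `|w|.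
Proof.
rewrite /dotv (le_trans (ler_norm_sum _ _ _))// mulr_suml ler_sum// => i _.
by rewrite normrM ler_wpM2l// coord_le_norm.
Qed.

Lemma dotvDr p v w : dotv p (v + w) = dotv p v + dotv p w.
Proof. by rewrite /dotv -big_split; apply: eq_bigr => i _; rewrite mxE mulrDr. Qed.

Lemma dotvZr p a v : dotv p (a *: v) = a * dotv p v.
Proof. by rewrite /dotv mulr_sumr; apply: eq_bigr => i _; rewrite mxE mulrCA. Qed.

Lemma dotvC v w : dotv v w = dotv w v.
Proof. by apply: eq_bigr => i _; rewrite mulrC. Qed.

Lemma dotvDl p v w : dotv (v + w) p = dotv v p + dotv w p.
Proof. by rewrite dotvC dotvDr !(dotvC p). Qed.

Lemma dotvZl p a v : dotv (a *: v) p = a * dotv v p.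
Proof. by rewrite dotvC dotvZr (dotvC p). Qed.

Lemma dotvNl p v : dotv (- v) p = - dotv v p.
Proof. by rewrite -scaleN1r dotvZl mulN1r. Qed.

Lemma differentiable_eps psi x : differentiable psi x ->
  forall e : R, 0 < e -> exists2 dl : R, 0 < dl &
    forall y, `|y| < dl -> `|psi (x + y) - psi x - 'd psi x y| <= e * `|y|.
Proof.
move=> dp e e0; have /eqaddoP/(_ e e0)/nbhs_ballP[dl /= dl0 dlP] := diff_locally dp.
exists dl => // y yd; have := dlP y; rewrite -ball_normE /= sub0r normrN => /(_ yd).
by rewrite -[X in `|X|]/(psi (y + x) - (psi x + 'd psi x y)) [y + x]addrC opprD addrA.
Qed.

Lemma Ham_has_ubound (L : 'rV[R]_d -> 'rV[R]_d -> R) x p :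
  continuous (fun xv : 'rV[R]_d * 'rV[R]_d => L xv.1 xv.2) ->
  periodic_lagrangian L -> superlinear L ->
  has_ubound (range (fun v => dotv p v - L x v)).
Proof.
move=> cL pL sL.
have [m mL] := lagrangian_ge cL pL sL.
pose C := \sum_i `|p ord0 i|; have C0 : 0 <= C by apply: sumr_ge0.
have [r rP] := sL C.
exists (Num.max 0 (C * Num.max 0 r - m)) => _ [v _ <-].
have pv : dotv p v <= C * `|v| by apply: le_trans (ler_norm _) (dotv_le p v).
have ev : C * `|v| <= C * enorm v by rewrite ler_wpM2l// norm_le_enorm.
have [er|er] := leP (enorm v) r.
  rewrite le_max; apply/orP; right; have := mL x v.
  have : C * enorm v <= C * Num.max 0 r by rewrite ler_wpM2l// le_max er orbT.
  by lra.
by rewrite le_max; apply/orP; left; have := rP x v er; lra.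
Qed.

Lemma supersolution_le (L : 'rV[R]_d -> 'rV[R]_d -> R) phi (Hbar l : R) psi :
  viscosity_solution L phi Hbar -> test_function psi ->
  (forall x v, l <= L x v + tdiff psi x v) -> l <= - Hbar.
Proof.
move=> [cphi pphi _ super] tp lP; have [[dp _] pp] := tp.
have [||x0 x0P] := @periodic_EVT_min R d (fun x => phi x - psi x).
- by move=> x; exact: (cvgB (cphi x) (differentiable_continuous (dp x))).
- by move=> x k; rewrite pphi pp.
pose p : 'rV[R]_d := \row_i 'D_(delta_mx ord0 i) psi x0.
have pE w : dotv p w = tdiff psi x0 w.
  rewrite tdiffE diff_coord//; apply: eq_bigr => i _; rewrite mxE mulrC//.
have sub : hsubdiff phi x0 p.
  move=> w e e0; pose C := \sum_i `|p ord0 i|; have C0 : 0 <= C by apply: sumr_ge0.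
  pose eta := e / (4 * (`|w| + 1)).
  have w1 : 0 < `|w| + 1 by rewrite ltr_wpDl.
  have eta0 : 0 < eta by rewrite divr_gt0// mulr_gt0.
  have [dl dl0 dlP] := differentiable_eps (dp x0) eta0.
  have C1 : 0 < C + 1 by rewrite ltr_wpDl.
  (* Radius at most 1 gives [|w'| <= |w| + 1]. One [e / 4] pays for the differentiability error,
     another for replacing [w] by [w'] in the linear term. *)
  apply: (@near_right_prod _ _ (dl / (`|w| + 1)) (Num.min 1 (e / (4 * (C + 1))))).
  - by rewrite divr_gt0.
  - by rewrite lt_min ltr01 divr_gt0// mulr_gt0.
  move=> h w' /andP[h0 hdl]; rewrite lt_min => /andP[ww1 wwe].
  have w'w : `|w'| <= `|w| + 1.
    have -> : w' = w - (w - w') by rewrite opprB addrC subrK.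
    by rewrite (le_trans (ler_normB _ _))// lerD2l ltW.
  have hw : `|h *: w'| < dl.
    rewrite normrZ gtr0_norm//; apply: (@le_lt_trans _ _ (h * (`|w| + 1))).
      by rewrite ler_pM2l.
    by rewrite -ltr_pdivlMr.
  have := dlP _ hw; rewrite -tdiffE tdiffZr normrZ gtr0_norm// ler_norml => /andP[d1 _].
  have := x0P (x0 + h *: w') => min.
  have cont : dotv p w - e / 4 <= tdiff psi x0 w'.
    rewrite -pE; have -> : dotv p w = dotv p w' + dotv p (w - w').
      by rewrite -dotvDr addrC subrK.
    have : dotv p (w - w') <= C * `|w - w'| by apply: le_trans (ler_norm _) (dotv_le _ _).
    have : (C + 1) * `|w - w'| <= e / 4.
      rewrite mulrC -ler_pdivlMr//; apply: le_trans (ltW wwe) _.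
      by rewrite invfM mulrA.
    have := normr_ge0 (w - w'); nra.
  have etaw : eta * `|w'| <= e / 4.
    have E : eta * (`|w| + 1) = e / 4 by rewrite /eta; field; rewrite gt_eqF.
    by rewrite -E ler_pM2l.
  rewrite ler_pdivlMr// mulrC.
  have : h * (dotv p w - e) <= h * (tdiff psi x0 w' - eta * `|w'|).
    by rewrite ler_pM2l//; lra.
  by lra.
have := super x0 p sub; move=> HH.
suff : Ham L x0 (- p) <= - l by lra.
apply: ge_sup; first by exists (dotv (- p) 0 - L x0 0), 0.
by move=> _ [v _ <-]; rewrite dotvNl pE; have := lP x0 v; lra.
Qed.

(** [S x] is the maximum over [w] of [phi (x + w) - k * |w|^2], with the Euclidean norm. At the
    maximizer [W x], a paraboloid touches [phi] from above at [y = x + W x], so [2 * k * W x] is a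
    supergradient there and the subsolution property applies. The point [y] depends on [x] only, so
    one [y] serves all [v] and [t]. *)
Lemma sup_convolution (L : 'rV[R]_d -> 'rV[R]_d -> R) phi (Hbar rho : R) :
  continuous (fun xv : 'rV[R]_d * 'rV[R]_d => L xv.1 xv.2) ->
  periodic_lagrangian L -> superlinear L ->
  viscosity_solution L phi Hbar -> 0 < rho ->
  exists S : 'rV[R]_d -> R, exists k : R,
    [/\ continuous S, Defs.periodic S & forall x, exists2 y, `|x - y| <= rho &
      forall v t, 0 <= t ->
      S x - t * (L y v + Hbar) - k * t ^+ 2 * dotv v v <= S (x + t *: v)].
Proof.
move=> cL pL sL [cphi pphi subsol _] rho0.
have [C C0 CP] := periodic_bounded cphi pphi.
(* Beyond distance [rho] the penalty exceeds the oscillation [2 * C] of [phi], so the maximizer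
   stays within [rho]. *)
pose k := (2 * C + 1) / rho ^+ 2.
have rho20 : 0 < rho ^+ 2 by rewrite exprn_gt0.
have k0 : 0 < k by rewrite divr_gt0//; lra.
have krho : k * rho ^+ 2 = 2 * C + 1 by rewrite divfK// gt_eqF.
pose q x w := phi (x + w) - k * dotv w w.
have cdot : continuous (fun w : 'rV[R]_d => dotv w w).
  move=> w; rewrite (_ : (fun w => dotv w w) = \sum_i (fun w : 'rV[R]_d => w ord0 i * w ord0 i)).
    apply: (big_ind (fun f : 'rV[R]_d -> R => {for w, continuous f})).
    - exact: cst_continuous.
    - by move=> f g cf cg; exact: continuousD.
    - by move=> i _; exact: (cvgM (@coord_continuous _ _ _ ord0 i w) (@coord_continuous _ _ _ ord0 i w)).
  by apply/funext => u; rewrite fct_sumE.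
have cq x : continuous (q x).
  move=> w.
  have c1 : {for w, continuous (fun w => phi (x + w))}.
    apply: (@continuous_comp _ _ _ (fun w => x + w) phi); last exact: cphi.
    exact: (cvgD (cvg_cst x) (@cvg_id _ (nbhs w))).
  have c2 : {for w, continuous (fun w : 'rV[R]_d => k * dotv w w)}.
    exact: (cvgM (cvg_cst k) (cdot w)).
  exact: cvgB c1 c2.
have out x w : rho < `|w| -> q x w <= q x 0.
  move=> wr; rewrite /q addr0; have -> : dotv (0 : 'rV[R]_d) 0 = 0.
    by rewrite -[X in dotv X _](scale0r 0) dotvZl mul0r.
  have := CP (x + w); have := CP x; rewrite !ler_norml.
  have : k * rho ^+ 2 <= k * dotv w w.
    rewrite ler_pM2l// (le_trans _ (sqr_norm_le_dotv w))//.
    by rewrite lerXn2r ?nnegrE ?ltW// (lt_trans rho0).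
  by rewrite krho; lra.
have /choice[W WP] : forall x, exists w, `|w| <= rho /\ forall w', q x w' <= q x w.
  move=> x.
  have [|w bw wP] := @compact_EVT_max _ R (q x) _ _ (@compact_box R d (- rho) rho)
    (continuous_subspaceT (cq x)).
    by exists 0 => i; rewrite mxE; apply/andP; split; lra.
  have wr : `|w| <= rho by apply/(box_norm _ (ltW rho0)); rewrite inE in bw.
  exists w; split=> // w'; have [w'r|w'r] := leP `|w'| rho.
    by apply: wP; rewrite inE; apply/(box_norm _ (ltW rho0)).
  apply: le_trans (out _ _ w'r) _; apply: wP; rewrite inE; apply/(box_norm _ (ltW rho0)).
  by rewrite normr0 ltW.
pose S x := q x (W x).
have Sge x w : q x w <= S x by exact: (WP x).2.
(* Testing [x'] with the maximizer of [x] transfers the modulus of continuity and the periodicity of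
   [phi] to [S]. *)
have Sdiff x x' : S x + phi (x' + W x) - phi (x + W x) <= S x'.
  by apply: le_trans (Sge x' (W x)); rewrite /S /q; lra.
exists S, k; split.
- move=> x; apply/continuous_epsP => e e0.
  have [dl dl0 dlP] := periodic_unif_continuous cphi pphi e0.
  exists dl => // x' xx'; rewrite ltr_norml; apply/andP; split.
    have /dlP : `|(x' + W x') - (x + W x')| < dl.
      by rewrite opprD addrACA subrr addr0 distrC.
    by have := Sdiff x' x; rewrite ltr_norml; lra.
  have /dlP : `|(x' + W x) - (x + W x)| < dl.
    by rewrite opprD addrACA subrr addr0 distrC.
  by have := Sdiff x x'; rewrite ltr_norml; lra.
- move=> x n; apply/eqP; rewrite eq_le; apply/andP; split.
    have := Sdiff (x + int_shift n) x.
    by rewrite (addrAC x) pphi; lra.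
  have := Sdiff x (x + int_shift n).
  by rewrite (addrAC x) pphi; lra.
- move=> x; pose y := x + W x; pose p := (2 * k) *: W x.
  exists y; first by rewrite /y opprD addrA subrr sub0r normrN; exact: (WP x).1.
  have sup_p : hsuperdiff phi y p.
    move=> w e e0; pose B := \sum_i `|p ord0 i|; have B0 : 0 <= B by apply: sumr_ge0.
    pose D := k * (d%:R * (`|w| + 1) ^+ 2).
    have D0 : 0 <= D by apply: mulr_ge0; [exact: ltW|apply: mulr_ge0 => //; apply: exprn_ge0; rewrite addr_ge0].
    have D1 : 0 < D + 1 by lra.
    have B1 : 0 < B + 1 by lra.
    apply: (@near_right_prod _ _ (e / 2 / (D + 1)) (Num.min 1 (e / 2 / (B + 1)))).
    - by rewrite !divr_gt0.
    - by rewrite lt_min ltr01 !divr_gt0.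
    move=> h w' /andP[h0 hD]; rewrite lt_min => /andP[ww1 wwe].
    have w'w : `|w'| <= `|w| + 1.
      have -> : w' = w - (w - w') by rewrite opprB addrC subrK.
      by rewrite (le_trans (ler_normB _ _))// lerD2l ltW.
    have dw' : k * dotv w' w' <= D.
      rewrite ler_pM2l// (le_trans (dotv_le_sqr_norm _))// ler_wpM2l//.
      by rewrite lerXn2r ?nnegrE ?addr_ge0.
    have hD' : h * (k * dotv w' w') <= e / 2.
      apply: (@le_trans _ _ (h * (D + 1))); first by rewrite ler_pM2l//; lra.
      by rewrite -ler_pdivlMr// ltW.
    have pw : dotv p w' <= dotv p w + e / 2.
      have -> : w' = w + (w' - w) by rewrite addrC subrK.
      rewrite dotvDr lerD2l (le_trans (ler_norm _))// (le_trans (dotv_le _ _))//.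
      rewrite distrC -/B; apply: (@le_trans _ _ ((B + 1) * `|w - w'|)).
        by rewrite ler_wpM2r// lerDl.
      by rewrite mulrC -ler_pdivlMr// ltW.
    rewrite ler_pdivrMr//.
    have := Sge x (W x + h *: w'); rewrite /S /q addrA -/y.
    rewrite !(dotvDl, dotvDr, dotvZl, dotvZr) (dotvC w' (W x)) => Hq.
    have pE : dotv p w' = 2 * k * dotv (W x) w' by rewrite dotvZl.
    have : h * dotv p w' + h * (h * (k * dotv w' w')) <= h * (dotv p w + e).
      rewrite -mulrDr ler_pM2l//; lra.
    by rewrite -(dotvZl w (2 * k) (W x)) -/p pE; lra.
  move=> v t t0.
  have : - dotv p v - L y v <= Hbar.
    apply: le_trans (subsol y p sup_p); rewrite -dotvNl.
    apply: ub_le_sup; last by exists v.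
    exact: Ham_has_ubound.
  (* The base point moves but the point [y] is kept, so [phi] cancels and only the penalty has to be
     expanded. *)
  move=> Hp; have := Sge (x + t *: v) (W x + (- t) *: v).
  rewrite /S /q (_ : x + t *: v + (W x + (- t) *: v) = x + W x); last first.
    by rewrite scaleNr addrACA subrr addr0.
  rewrite !(dotvDl, dotvDr, dotvZl, dotvZr) (dotvC v (W x)).
  have pE : dotv p v = 2 * k * dotv (W x) v by rewrite dotvZl.
  have : t * (- dotv p v - L y v) <= t * Hbar by rewrite ler_wpM2l.
  rewrite pE; set a := dotv (W x) v; set b := dotv v v; set c := dotv (W x) (W x).
  by set l := L y v; move=> ? ?; lra.
Qed.

End Viscosity.

(** * One-dimensional averages of continuous functions *)

Section Mean.
Context {R : realType}.
Variables (eps : R) (eps0 : 0 < eps).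

(** The lower limit -2 leaves room for the points [t + h] with [0 <= t] and [|h| < 1]. *)
Lemma antiderivative (f : R -> R) : continuous f ->
  exists F : R -> R, forall t : R, -2 < t -> is_derive t 1 F (f t).
Proof.
move=> cf; exists (fun x => \int[lebesgue_measure]_(t in `[-2, x]) f t).
move=> t t2.
have [||||dF dE] := @continuous_FTC1 R f (BLeft (-2)) t (t + 1).
- by rewrite ltrDl.
- apply: continuous_compact_integrable; first exact: segment_compact.
  exact: continuous_subspaceT.
- by rewrite /= lte_fin.
- exact: cf.
split; first exact: dF.
by apply: etrans (esym (derive1E _ _)) dE.
Qed.

Lemma derive_diff_ge (F f : R -> R) (a b m : R) : a <= b ->
  (forall t : R, a <= t <= b -> is_derive t 1 F (f t)) ->
  (forall t, a <= t <= b -> m <= f t) -> m * (b - a) <= F b - F a.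
Proof.
rewrite le_eqVlt => /orP[/eqP <- _ _|ab dF mf]; first by rewrite !subrr mulr0.
have dF' x : x \in `]a, b[ -> is_derive x 1 F (f x).
  by rewrite in_itv/= => /andP[? ?]; apply: dF; rewrite !ltW.
have cF : {within `[a, b], continuous F}.
  apply: derivable_within_continuous => t; rewrite in_itv/= => tab.
  by have [] := dF t tab.
have [c + ->] := MVT ab dF' cF.
rewrite in_itv/= => /andP[ac cb]; rewrite ler_pM2r ?subr_gt0//.
by apply: mf; rewrite !ltW.
Qed.

Lemma derive_diff_approx (F f : R -> R) (a b c e : R) : a <= b ->
  (forall t : R, a <= t <= b -> is_derive t 1 F (f t)) ->
  (forall t, a <= t <= b -> `|f t - c| <= e) ->
  `|F b - F a - c * (b - a)| <= e * (b - a).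
Proof.
move=> ab dF fc.
have H1 : (c - e) * (b - a) <= F b - F a.
  apply: (derive_diff_ge ab dF) => t /fc; rewrite ler_norml; lra.
have H2 : (- (c + e)) * (b - a) <= (- F) b - (- F) a.
  apply: (@derive_diff_ge _ (fun t => - f t)) => // t tab.
    by have := dF t tab => ?; apply: is_deriveN.
  by have := fc t tab; rewrite ler_norml; lra.
move: H2; rewrite -[(- F) b]/(- F b) -[(- F) a]/(- F a) => H2.
by rewrite ler_norml; apply/andP; split; lra.
Qed.

(* [mean f] is the average of the continuous function [f] over [0, eps]. *)
Definition primitive (f : R -> R) : R -> R :=
  xget (fun=> 0) [set F | forall t : R, -2 < t -> is_derive t 1 F (f t)].
Definition mean (f : R -> R) : R := (primitive f eps - primitive f 0) / eps.

Lemma primitiveP (f : R -> R) : continuous f -> forall t : R, -2 < t -> is_derive t 1 (primitive f) (f t).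
Proof. by move=> /antiderivative h; exact: (xgetPex (fun=> 0) h). Qed.

Lemma mean_unique (f F : R -> R) : continuous f ->
  (forall t : R, 0 <= t <= eps -> is_derive t 1 F (f t)) -> mean f = (F eps - F 0) / eps.
Proof.
move=> cf dF; congr (_ / _); apply/eqP; rewrite -subr_eq0 -normr_le0.
have := @derive_diff_approx (primitive f \- F) (fun=> 0) 0 eps 0 0 (ltW eps0).
rewrite !mul0r !subr0 /= => H.
rewrite (_ : _ - _ = primitive f eps - F eps - (primitive f 0 - F 0)); last by ring.
apply: H => [t t0|t _]; last by rewrite normr0.
have h1 : is_derive t 1 (primitive f) (f t) by apply: primitiveP => //; lra.
have h2 := dF t t0.
by rewrite -(subrr (f t)); apply: is_deriveB.
Qed.

Lemma mean_leD (f g : R -> R) (c : R) : continuous f -> continuous g ->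
  (forall t, 0 <= t <= eps -> f t <= g t + c) -> mean f <= mean g + c.
Proof.
move=> cf cg fg.
have H : (- c) * (eps - 0) <= (primitive g \- primitive f) eps - (primitive g \- primitive f) 0.
  apply: (@derive_diff_ge _ (fun t => g t - f t)); first exact: ltW.
    move=> t t0; have h1 : is_derive t 1 (primitive f) (f t) by apply: primitiveP => //; lra.
    have h2 : is_derive t 1 (primitive g) (g t) by apply: primitiveP => //; lra.
    exact: is_deriveB.
  by move=> t /fg; lra.
rewrite /mean ler_pdivrMr// mulrDl divfK ?gt_eqF//.
by move: H => /=; lra.
Qed.

Lemma mean_lin (f g : R -> R) (a : R) : continuous f -> continuous g ->
  mean (fun t => f t + a * g t) = mean f + a * mean g.
Proof.
move=> cf cg.
have cfg : continuous (fun t => f t + a * g t).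
  move=> t; have c2 : {for t, continuous (fun t => a * g t)}.
    exact: (cvgM (cvg_cst a) (cg t)).
  exact: (cvgD (cf t) c2).
have dfg (t : R) : 0 <= t <= eps ->
    is_derive t 1 (fun t => primitive f t + a * primitive g t) (f t + a * g t).
  move=> t0; have h1 : is_derive t 1 (primitive f) (f t) by apply: primitiveP => //; lra.
  have h2 : is_derive t 1 (primitive g) (g t) by apply: primitiveP => //; lra.
  have h3 : is_derive t 1 (a \*: primitive g) (a *: g t) by apply: is_deriveZ.
  exact: is_deriveD.
by rewrite (mean_unique cfg dfg) /mean; ring.
Qed.

(** Shifting the window [0, eps] by [h] adds a strip at one end and removes one at the other. Hence
    the average is differentiable in the shift even if [f] is only continuous, and its derivative is
    a difference quotient of [f]. *)
Lemma mean_shift (f : R -> R) (h e : R) : continuous f -> `|h| < 1 ->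
  (forall t, `|t - 0| <= `|h| -> `|f t - f 0| <= e) ->
  (forall t, `|t - eps| <= `|h| -> `|f t - f eps| <= e) ->
  `|mean (fun t => f (t + h)) - mean f - h * ((f eps - f 0) / eps)| <= 2 * e / eps * `|h|.
Proof.
move=> cf h1 H0 Heps; set F := primitive f.
have dF (t : R) : -2 < t -> is_derive t 1 F (f t) by exact: primitiveP.
have approx a : 0 <= a -> (forall t, `|t - a| <= `|h| -> `|f t - f a| <= e) ->
    `|F (a + h) - F a - f a * h| <= e * `|h|.
  move=> a0 Ha; move: h1; rewrite ltr_norml => /andP[h1 h2].
  have [h0|h0] := leP 0 h.
    have := @derive_diff_approx F f a (a + h) (f a) e.
    rewrite (_ : a + h - a = h); last by ring.
    rewrite (ger0_norm h0); apply.
    - lra.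
    - by move=> t ?; apply: dF; lra.
    - by move=> t ?; apply: Ha; rewrite (ger0_norm h0) ler_norml; lra.
  have := @derive_diff_approx F f (a + h) a (f a) e.
  rewrite (_ : a - (a + h) = - h); last by ring.
  rewrite (ltr0_norm h0) => H.
  rewrite (_ : F (a + h) - F a - f a * h = - (F a - F (a + h) - f a * - h)); last by ring.
  rewrite normrN; apply: H.
  - lra.
  - by move=> t ?; apply: dF; lra.
  - by move=> t ?; apply: Ha; rewrite (ltr0_norm h0) ler_norml; lra.
have cfh : continuous (fun t => f (t + h)).
  move=> t; apply: (@continuous_comp _ _ _ (fun t => t + h) f); last exact: cf.
  exact: (cvgD (@cvg_id _ (nbhs t)) (cvg_cst h)).
have dFh (t : R) : 0 <= t <= eps -> is_derive t 1 (fun t => F (t + h)) (f (t + h)).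
  move=> t0; move: h1; rewrite ltr_norml => /andP[h1 h2].
  have d1 : is_derive (t + h) 1 F (f (t + h)) by apply: dF; lra.
  have d2 : is_derive t (1 : R) (fun t => t + h) 1.
    by rewrite -[X in is_derive _ _ _ X]addr0; apply: is_deriveD.
  have := @is_derive1_comp R F (fun t => t + h) t (f (t + h)) 1 d1 d2.
  by rewrite mulr1.
rewrite (mean_unique cfh dFh).
rewrite /mean -/F.
have A0 := approx 0 (lexx _) H0; have Ae := approx eps (ltW eps0) Heps.
rewrite add0r in A0 *.
rewrite (_ : _ - _ - _ = (F (eps + h) - F eps - f eps * h - (F h - F 0 - f 0 * h)) / eps); last first.
  by ring.
rewrite normrM normfV (gtr0_norm eps0) mulrAC ler_pM2r ?invr_gt0//.
by rewrite (le_trans (ler_normB _ _))//; lra.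
Qed.

End Mean.

(** * Averages over small cubes *)

Section Mollifier.
Context {R : realType} {d : nat}.
Variables (eps : R) (eps0 : 0 < eps).
Implicit Types (x y : 'rV[R]_d) (u w : 'rV[R]_d -> R).

Let b (i : 'I_d) : 'rV[R]_d := delta_mx ord0 i.

Definition continuous_periodic u := continuous u /\ Defs.periodic u.

Lemma continuous_line u x i : continuous u -> continuous (fun s : R => u (x + s *: b i)).
Proof.
move=> cu s; apply: (@continuous_comp _ _ _ (fun s : R => x + s *: b i) u); last exact: cu.
exact: (cvgD (cvg_cst x) (cvgZl (@cvg_id _ (nbhs s)))).
Qed.

Definition avg (i : 'I_d) u x : R := mean eps (fun s => u (x + s *: b i)).

Lemma norm_basis i : `|b i| <= 1.
Proof.
apply: norm_le_coord => // j; rewrite mxE eqxx /=.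
by case: (j == i); rewrite ?normr1 ?normr0.
Qed.

Lemma norm_line (s : R) i : `|s *: b i| <= `|s|.
Proof. by rewrite normrZ ler_piMr// norm_basis. Qed.

Lemma avg_leD i u w x y c : continuous u -> continuous w ->
  (forall s, 0 <= s <= eps -> u (x + s *: b i) <= w (y + s *: b i) + c) ->
  avg i u x <= avg i w y + c.
Proof. by move=> cu cw h; apply: mean_leD => //; exact: continuous_line. Qed.

Lemma avg_continuous_periodic i u : continuous_periodic u -> continuous_periodic (avg i u).
Proof.
move=> [cu pu]; split=> [x|x k]; last first.
  rewrite /avg; congr mean; apply/funext => s; rewrite addrAC; exact: pu.
apply/continuous_epsP => e e0; have e20 : 0 < e / 2 by rewrite divr_gt0.
have [dl dl0 dlP] := periodic_unif_continuous cu pu e20.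
exists dl => // y xy.
have xys s : `|(x + s *: b i) - (y + s *: b i)| < dl.
  by rewrite opprD addrACA subrr addr0.
apply: (@le_lt_trans _ _ (e / 2)); last lra.
have h1 : avg i u x <= avg i u y + e / 2.
  by apply: avg_leD => // s _; have := dlP _ _ (xys s); rewrite ltr_norml; lra.
have h2 : avg i u y <= avg i u x + e / 2.
  by apply: avg_leD => // s _; have := dlP _ _ (xys s); rewrite ltr_norml; lra.
by rewrite ler_norml; lra.
Qed.

(** The partial derivative is uniform in the base point, so that it passes through an average in
    another direction without differentiating under the integral. *)
Definition unif_partial (j : 'I_d) u w :=
  forall e : R, 0 < e -> exists2 dl : R, 0 < dl & forall y (h : R), `|h| < dl ->
    `|u (y + h *: b j) - u y - h * w y| <= e * `|h|.

Lemma avg_unif_partial i j u w : continuous_periodic u -> continuous_periodic w ->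
  unif_partial j u w -> unif_partial j (avg i u) (avg i w).
Proof.
move=> [cu pu] [cw pw] H e e0; have [dl dl0 dlP] := H e e0.
exists dl => // y h hdl.
have cl z : continuous (fun s : R => u (z + s *: b i)) by exact: continuous_line.
have cwl : continuous (fun s : R => w (y + s *: b i)) by exact: continuous_line.
have E : avg i u y + h * avg i w y =
    mean eps (fun s => u (y + s *: b i) + h * w (y + s *: b i)).
  by rewrite mean_lin.
have cc : continuous (fun s : R => u (y + s *: b i) + h * w (y + s *: b i)).
  move=> s; have c2 : {for s, continuous (fun s : R => h * w (y + s *: b i))}.
    exact: (cvgM (cvg_cst h) (cwl s)).
  exact: (cvgD (cl y s) c2).
have R1 s : `|u (y + h *: b j + s *: b i) - u (y + s *: b i) - h * w (y + s *: b i)| <= e * `|h|.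
  by rewrite (addrAC y (h *: b j)); exact: dlP.
have h1 : avg i u (y + h *: b j) <= avg i u y + h * avg i w y + e * `|h|.
  rewrite E; apply: mean_leD => // s _.
  by have := R1 s; rewrite ler_norml; lra.
have h2 : avg i u y + h * avg i w y <= avg i u (y + h *: b j) + e * `|h|.
  rewrite E; apply: mean_leD => // s _.
  by have := R1 s; rewrite ler_norml; lra.
by rewrite ler_norml; lra.
Qed.

Definition quotient i u x : R := (u (x + eps *: b i) - u x) / eps.

Lemma quotient_continuous_periodic i u : continuous_periodic u -> continuous_periodic (quotient i u).
Proof.
move=> [cu pu]; split=> [x|x k]; last by rewrite /quotient addrAC !pu.
have c1 : {for x, continuous (fun x => u (x + eps *: b i))}.
  apply: (@continuous_comp _ _ _ (fun x => x + eps *: b i) u); last exact: cu.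
  exact: (cvgD (@cvg_id _ (nbhs x)) (cvg_cst (eps *: b i))).
have c2 : {for x, continuous (fun x => u (x + eps *: b i) - u x)}.
  exact: (cvgB c1 (cu x)).
exact: (cvgM c2 (cvg_cst eps^-1)).
Qed.

Lemma avg_partial i u : continuous_periodic u -> unif_partial i (avg i u) (quotient i u).
Proof.
move=> [cu pu] e e0; have e1 : 0 < e * eps / 2 by rewrite divr_gt0 ?mulr_gt0.
have [dl dl0 dlP] := periodic_unif_continuous cu pu e1.
exists (Num.min 1 dl); first by rewrite lt_min ltr01.
move=> y h; rewrite lt_min => /andP[h1 hdl].
have cl : continuous (fun s : R => u (y + s *: b i)) by exact: continuous_line.
have osc a t : `|t - a| <= `|h| -> `|u (y + t *: b i) - u (y + a *: b i)| <= e * eps / 2.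
  move=> ta; rewrite ltW// dlP// opprD addrACA subrr add0r -scalerBl.
  by rewrite (le_lt_trans (norm_line _ _))// (le_lt_trans ta).
have := mean_shift eps0 cl h1 (osc 0) (osc eps).
rewrite scale0r addr0 (_ : 2 * (e * eps / 2) / eps = e); last by field; rewrite gt_eqF.
rewrite -/(quotient i u y) -/(avg i u y).
have -> : mean eps (fun t => u (y + (t + h) *: b i)) = avg i u (y + h *: b i).
  by rewrite /avg; congr mean; apply/funext => t; rewrite scalerDl [t *: _ + _]addrC addrA.
by [].
Qed.

Definition mollify (l : seq 'I_d) u := foldr avg u l.

Lemma mollify_continuous_periodic l u : continuous_periodic u -> continuous_periodic (mollify l u).
Proof. by move=> su; elim: l => //= i l IH; exact: avg_continuous_periodic. Qed.

Lemma mollify_partial l u : continuous_periodic u -> forall i, i \in l ->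
  exists2 w, continuous_periodic w & unif_partial i (mollify l u) w.
Proof.
move=> su; elim: l => //= j l IH i; rewrite inE => /orP[/eqP ->|il].
  exists (quotient j (mollify l u)); first exact/quotient_continuous_periodic/mollify_continuous_periodic.
  exact/avg_partial/mollify_continuous_periodic.
have [w sw Hw] := IH i il.
exists (avg j w); first exact: avg_continuous_periodic.
by apply: avg_unif_partial => //; exact: mollify_continuous_periodic.
Qed.

(** With [t] and the increment [a] fixed, the inequality holds at every translate and is linear in
    [u], so it can be averaged. Each direction moves [ell] by at most [dl]. *)
Lemma mollify_subsolution l u (ell : 'rV[R]_d -> R) a (t c dl : R) :
  continuous_periodic u -> 0 <= t ->
  (forall x i s, 0 <= s <= eps -> `|ell (x + s *: b i) - ell x| <= dl) ->
  (forall x, u x - t * ell x - c <= u (x + a)) ->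
  forall x, mollify l u x - t * (ell x + (size l)%:R * dl) - c <= mollify l u (x + a).
Proof.
move=> su t0 osc sub; elim: l => [|i l IH] x /=.
  by rewrite mul0r addr0; exact: sub.
have [cu _] := mollify_continuous_periodic l su; set v := mollify l u in IH cu *.
suff : avg i v x <= avg i v (x + a) + (t * (ell x + (size l).+1%:R * dl) + c) by lra.
apply: avg_leD => // s s01.
have := IH (x + s *: b i); rewrite (addrAC x a).
have : t * ell (x + s *: b i) <= t * (ell x + dl).
  by rewrite ler_wpM2l//; have := osc x i s s01; rewrite ler_norml; lra.
by rewrite -natr1; lra.
Qed.

End Mollifier.

(** * From continuous partial derivatives to C^1 regularity *)

Section ContinuousPartials.
Context {R : realType} {d : nat}.
Implicit Types (x y z : 'rV[R]_d) (u : 'rV[R]_d -> R).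

Lemma unif_partials_test_function u (w : 'I_d -> 'rV[R]_d -> R) :
  Defs.periodic u -> (forall i, continuous_periodic (w i)) ->
  (forall i, unif_partial i u (w i)) -> test_function u.
Proof.
move=> pu sw pw.
pose b (i : 'I_d) : 'rV[R]_d := delta_mx ord0 i.
pose trunc (z : 'rV[R]_d) k : 'rV[R]_d := \row_j (if (j < k)%N then z ord0 j else 0).
have trS z (i : 'I_d) : trunc z i.+1 = trunc z i + z ord0 i *: b i.
  apply/rowP => j; rewrite !mxE eqxx /= ltnS leq_eqVlt.
  case: (eqVneq j i) => [->|ji]; first by rewrite ltnn eqxx /= add0r mulr1.
  by rewrite (negbTE (_ : val j != val i))// mulr0 addr0.
have tr0 z : trunc z 0 = 0 by apply/rowP => j; rewrite !mxE.
have trd z : trunc z d = z by apply/rowP => j; rewrite !mxE ltn_ord.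
have ntr z k : `|trunc z k| <= `|z|.
  apply: norm_le_coord => // j; rewrite mxE; case: ifP => _; last by rewrite normr0.
  exact: coord_le_norm.
pose D x z := \sum_i w i x * z ord0 i.
have approx x (e : R) : 0 < e -> exists2 dl, 0 < dl &
    forall z, `|z| < dl -> `|u (x + z) - u x - D x z| <= e * `|z|.
  (* Each of the [d] coordinate steps from [x] to [x + z] costs [2 * e']: half from the uniform
     partial derivative, half from the continuity of [w i] at [x]. Using [d.+1] keeps [e'] positive
     when [d] is 0. *)
  move=> e0; pose e' := e / (2 * d.+1%:R).
  have e'0 : 0 < e' by rewrite divr_gt0// mulr_gt0.
  have /choice[dl dlP] : forall i, exists dl : R, 0 < dl /\
      (forall y h, `|h| < dl -> `|u (y + h *: b i) - u y - h * w i y| <= e' * `|h|) /\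
      (forall y, `|x - y| < dl -> `|w i x - w i y| < e').
    move=> i; have [d1 d10 d1P] := pw i e' e'0.
    have [d2 d20 d2P] := (continuous_epsP (w i) x).1 ((sw i).1 x) e' e'0.
    exists (Num.min d1 d2); split; first by rewrite lt_min d10.
    by split=> [y h|y]; rewrite lt_min => /andP[? ?]; [exact: d1P|exact: d2P].
  pose m := \big[Num.min/1]_i dl i.
  have m0 : 0 < m by apply: lt_bigmin => // i _; exact: (dlP i).1.
  have mdl i : m <= dl i by exact: bigmin_le.
  exists m => // z zm.
  have step (i : 'I_d) : `|u (x + trunc z i.+1) - u (x + trunc z i) - w i x * z ord0 i|
      <= 2 * e' * `|z|.
    have [_ [H1 H2]] := dlP i.
    have zi : `|z ord0 i| < dl i.
      by rewrite (le_lt_trans (coord_le_norm _ _))// (lt_le_trans zm).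
    have A1 := H1 (x + trunc z i) (z ord0 i) zi.
    have /H2 A2 : `|x - (x + trunc z i)| < dl i.
      rewrite opprD addrA subrr sub0r normrN (le_lt_trans (ntr _ _))//.
      exact: lt_le_trans zm (mdl i).
    have A3 : `|z ord0 i * (w i (x + trunc z i) - w i x)| <= e' * `|z|.
      rewrite normrM mulrC; apply: ler_pM => //; first by rewrite distrC ltW.
      exact: coord_le_norm.
    have A4 : e' * `|z ord0 i| <= e' * `|z| by rewrite ler_pM2l// coord_le_norm.
    rewrite trS addrA.
    rewrite (_ : _ - _ - _ = (u (x + trunc z i + z ord0 i *: b i) - u (x + trunc z i) -
      z ord0 i * w i (x + trunc z i)) + z ord0 i * (w i (x + trunc z i) - w i x)); last by ring.
    by rewrite (le_trans (ler_normD _ _))//; lra.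
  have tel : u (x + z) - u x = \sum_(i < d) (u (x + trunc z i.+1) - u (x + trunc z i)).
    rewrite -(big_mkord predT (fun k => u (x + trunc z k.+1) - u (x + trunc z k))).
    by rewrite (telescope_sumr (fun k => u (x + trunc z k)))// tr0 trd addr0.
  rewrite tel /D -sumrB (le_trans (ler_norm_sum _ _ _))//.
  apply: (@le_trans _ _ (\sum_(i < d) 2 * e' * `|z|)); first exact: ler_sum.
  rewrite sumr_const card_ord -[leLHS]mulr_natl [leLHS]mulrA ler_wpM2r//.
  have E : e' * (2 * d.+1%:R) = e by rewrite divfK// gt_eqF// mulr_gt0.
  by rewrite -E -[in leRHS]natr1; nra.
have linD x : linear (D x : 'rV[R]_d -> R^o).
  move=> a y z; rewrite /D scaler_sumr -big_split; apply: eq_bigr => i _ /=.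
  by rewrite !mxE; rewrite mulrDr [a *: _]mulrCA.
have dD x : exists f : {linear 'rV[R]_d -> R^o}, f = D x :> (_ -> _).
  pose HBD := GRing.isLinear.Build R 'rV[R]_d R^o _ (D x) (linD x).
  by exists (HB.pack (D x) HBD : {linear 'rV[R]_d -> R^o}).
have cD x : continuous (D x).
  move=> z; rewrite (_ : D x = \sum_i (fun z : 'rV[R]_d => w i x * z ord0 i)); last first.
    by apply/funext => y; rewrite fct_sumE.
  apply: (big_ind (fun f : 'rV[R]_d -> R => {for z, continuous f})).
  - exact: cst_continuous.
  - by move=> f g cf cg; exact: continuousD.
  - by move=> i _; exact: (cvgM (cvg_cst (w i x)) (@coord_continuous _ _ _ ord0 i z)).
have diffu x : differentiable u x /\ 'd u x = D x :> ('rV[R]_d -> R).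
  have [f fE] := dD x.
  have cf : continuous f by rewrite fE; exact: cD.
  have eqo : u \o shift x = cst (u x) + f +o_ (0 : 'rV[R]_d) id.
    apply/eqaddoP => e e0; have [dl dl0 dlP] := approx x e e0.
    apply/nbhs_ballP; exists dl => //= z; rewrite -ball_normE /= sub0r normrN => zdl.
    rewrite fE -[X in `|X|]/(u (z + x) - (u x + D x z)) [z + x]addrC opprD addrA.
    exact: dlP.
  have dE : 'd u x = f :> (_ -> _) by exact: diff_unique cf eqo.
  split; last by rewrite dE fE.
  by apply/diff_locallyP; rewrite dE.
split=> //; split=> [x|i]; first exact: (diffu x).1.
rewrite (_ : (fun x => _) = w i); first exact: (sw i).1.
apply/funext => x; have [dx dE] := diffu x.
rewrite deriveE// dE /D (bigD1 i)//= big1 ?addr0.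
  by rewrite mxE !eqxx mulr1.
by move=> j ji; rewrite mxE eqxx /= (negbTE ji) mulr0.
Qed.

End ContinuousPartials.

(** * Identification of the critical value and the theorem *)

Section CriticalValue.
Context {R : realType} {d : nat} (L : 'rV[R]_d -> 'rV[R]_d -> R).
Hypothesis cL : continuous (fun xv : 'rV[R]_d * 'rV[R]_d => L xv.1 xv.2).
Hypothesis pL : periodic_lagrangian L.
Hypothesis sL : superlinear L.

(** After division by a small [t], the quadratic term and the differentiability error each take half
    of [e]. *)
Lemma tdiff_ge (psi : 'rV[R]_d -> R) x v (a k : R) : test_function psi ->
  (forall t, 0 <= t -> psi x - t * a - k * t ^+ 2 <= psi (x + t *: v)) ->
  - a <= tdiff psi x v.
Proof.
move=> [[dp _] _] H; apply/ler_addgt0Pr => e e0.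
have v1 : 0 < `|v| + 1 by rewrite ltr_wpDl.
have k1 : 0 < `|k| + 1 by rewrite ltr_wpDl.
have eta0 : 0 < e / 2 / (`|v| + 1) by rewrite !divr_gt0.
have [dl dl0 dlP] := differentiable_eps (dp x) eta0.
pose t := Num.min (dl / 2 / (`|v| + 1)) (e / 2 / (`|k| + 1)).
have t0 : 0 < t by rewrite lt_min !divr_gt0.
have tdl : t * (`|v| + 1) <= dl / 2 by rewrite -ler_pdivlMr// ge_min lexx.
have te : t * (`|k| + 1) <= e / 2 by rewrite -ler_pdivlMr// ge_min lexx orbT.
have tv : `|t *: v| = t * `|v| by rewrite normrZ gtr0_norm.
have := dlP (t *: v); rewrite tv -tdiffE tdiffZr => /(_ _)/wrap[|]; first by lra.
rewrite ler_norml => /andP[_ h1]; have h2 := H t (ltW t0).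
have h3 : e / 2 / (`|v| + 1) * (t * `|v|) <= t * (e / 2).
  rewrite mulrCA ler_pM2l// mulrAC ler_pdivrMr// ler_pM2l ?divr_gt0//; lra.
have h4 : k * t ^+ 2 <= t * (e / 2).
  rewrite expr2 mulrCA ler_pM2l// mulrC; apply: le_trans te; rewrite ler_pM2l//.
  by have := ler_norm k; lra.
have : t * (- a) <= t * (tdiff psi x v + e) by lra.
by rewrite ler_pM2l.
Qed.

Theorem subsolution_ge phi (Hbar : R) : viscosity_solution L phi Hbar ->
  - Hbar <= critical_value L.
Proof.
move=> vphi; apply/ler_addgt0Pr => e0 e00.
(* The cap keeps [- Hbar - e] among the levels covered by [superlinear_extend]. *)
pose e := Num.min e0 1.
have e_gt0 : 0 < e by rewrite lt_min e00 ltr01.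
have e_le1 : e <= 1 by rewrite ge_min lexx orbT.
have e_le : e <= e0 by rewrite ge_min lexx.
have [r r1 ext] := superlinear_extend cL pL sL (- Hbar - 1) (- Hbar).
have r0 : 0 <= r by lra.
(* One share for each of the [d] averaging directions and one for the distance from [y] to the
   contact point of the sup-convolution. *)
pose e' := e / d.+1%:R.
have e'0 : 0 < e' by rewrite divr_gt0.
have [rho0 rho00 rhoP] := lagrangian_unif_continuous cL pL r0 e'0.
(* Half of the modulus serves both as radius of the sup-convolution and as side of the averaging
   cube; the factor turns non-strict distance bounds into strict ones. *)
have rho_gt0 : 0 < rho0 / 2 by lra.
have [S [k [cS pS SP]]] := sup_convolution cL pL sL vphi rho_gt0.
have sS : continuous_periodic S by [].
pose psi := mollify (rho0 / 2) (enum 'I_d) S.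
have tpsi : test_function psi.
  have /choice[w wP] : forall i, exists w, continuous_periodic w /\ unif_partial i psi w.
    move=> i; have [|w] := @mollify_partial R d _ rho_gt0 (enum 'I_d) S sS i.
      by rewrite mem_enum.
    by exists w.
  apply: (@unif_partials_test_function _ _ _ w).
  - by have [] := mollify_continuous_periodic rho_gt0 (enum 'I_d) sS.
  - by move=> i; exact: (wP i).1.
  - by move=> i; exact: (wP i).2.
suff : - Hbar - e <= critical_value L by lra.
apply: (critical_value_ub cL pL sL tpsi); apply: ext => //.
  by apply/andP; split; lra.
move=> x v vr.
pose ell y := L y v + Hbar + e'.
have H t : 0 <= t -> psi x - t * (ell x + d%:R * e') - (k * dotv v v) * t ^+ 2 <= psi (x + t *: v).
  move=> t0; rewrite (mulrAC k).
  have := @mollify_subsolution R d _ rho_gt0 (enum 'I_d) S ell (t *: v) t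
    (k * t ^+ 2 * dotv v v) e' sS t0.
  rewrite size_enum_ord; apply.
  - move=> y i s /andP[s0 s1]; rewrite /ell.
    have : `|L (y + s *: delta_mx ord0 i) v - L y v| < e'.
      apply: rhoP => //; rewrite addrAC subrr add0r (le_lt_trans (norm_line _ _))//.
      by rewrite ger0_norm//; lra.
    by rewrite (_ : _ + _ + _ - _ = L (y + s *: delta_mx ord0 i) v - L y v) => [/ltW//|]; ring.
  - move=> y; have [y' yy' y'P] := SP y; apply: le_trans (y'P v t t0).
    rewrite !lerD2r lerD2l lerN2 ler_wpM2l// /ell.
    have : `|L y v - L y' v| < e' by apply: rhoP => //; lra.
    by rewrite ltr_norml; lra.
have := tdiff_ge tpsi H; rewrite /ell.
have E : e' * (d%:R + 1) = e by rewrite natr1 divfK// pnatr_eq0.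
lra.
Qed.

Theorem viscosity_critical_value phi (Hbar : R) : viscosity_solution L phi Hbar ->
  critical_value L = - Hbar.
Proof.
move=> vphi; apply/eqP; rewrite eq_le (subsolution_ge vphi) andbT.
by apply: (critical_value_le cL pL sL) => m psi; exact: supersolution_le vphi.
Qed.

(** Absence of a duality gap: holonomic measures are the feasible points of the program dual to the
    one that defines [critical_value]. *)
Lemma inf_action : ereal_inf [set action L nu | nu in [set nu | holonomic nu]] =
  (critical_value L)%:E.
Proof.
apply/eqP; rewrite eq_le; apply/andP; split.
  have [mu hmu mule] := minimizing_measure cL pL sL.
  by apply: ge_ereal_inf; exists (action L mu) => //; exists mu.
by apply: le_ereal_inf_tmp => _ [nu hnu <-]; exact: holonomic_action_ge.
Qed.

End CriticalValue.

Theorem theorem4 (R : realType) (d : nat) (L : 'rV[R]_d -> 'rV[R]_d -> R) :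
  continuous (fun xv : 'rV[R]_d * 'rV[R]_d => L xv.1 xv.2) ->
  periodic_lagrangian L ->
  superlinear L ->
  (exists mu : @PM R d, Mather_measure L mu) /\
  (forall (mu : @PM R d) (phi : 'rV[R]_d -> R) (Hbar : R),
      Mather_measure L mu -> viscosity_solution L phi Hbar ->
      action L mu = (- Hbar)%:E).
Proof.
move=> cL pL sL; split=> [|mu phi Hbar [_ ->] vphi].
  have [mu hmu mule] := minimizing_measure cL pL sL.
  exists mu; split=> //; rewrite inf_action//; apply/eqP.
  by rewrite eq_le mule holonomic_action_ge.
by rewrite inf_action// (viscosity_critical_value cL pL sL vphi).
Qed.
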